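(* Let $m=m(n)\le(1+o(1))n$ and let $H$ be a fixed connected planar graph with more edges than vertices. Then $\mathbf{P}[P_{n,m}\text{ has a component isomorphic to } H]\to0$ as $n\to\infty$.
   Context: $\mathcal{P}(n,m)$ is the set of simple labelled planar graphs on vertex set $\{1,\ldots,n\}$ with exactly $m$ edges; $P_{n,m}$ is chosen uniformly at random from $\mathcal{P}(n,m)$. *)

(* Defs.v *)
From HB Require Import structures.
From mathcomp Require Import all_boot all_order all_algebra.
From mathcomp Require Import all_classical all_reals all_analysis.

Set Implicit Arguments.
Unset Strict Implicit.
Unset Printing Implicit Defensive.

Import Order.TTheory GRing.Theory Num.Theory.
Import numFieldNormedType.Exports.

Local Open Scope classical_set_scope.
Local Open Scope ring_scope.

Record sgraph (V : finType) := SGraph {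
  edges : {set {set V}};
  edges_card2 : [forall e in edges, #|e| == 2%N]
}.

HB.instance Definition _ (V : finType) := [isSub for @edges V].
HB.instance Definition _ (V : finType) := [Finite of sgraph V by <:].

(* Irreflexive, because [set x; x] does not have two elements. *)
Definition adj (V : finType) (G : sgraph V) : rel V :=
  fun x y => [set x; y]%SET \in edges G.

(* With no vertices the graph counts as disconnected. *)
Definition connected_graph (V : finType) (G : sgraph V) : Prop :=
  (0 < #|V|)%N /\ forall x y : V, connect (adj G) x y.

Definition isomorphic (V W : finType) (G : sgraph V) (H : sgraph W) : Prop :=
  exists2 f : V -> W, bijective f & forall x y, adj H (f x) (f y) = adj G x y.

Section Induced.
Variables (V : finType) (G : sgraph V) (C : {set V}).

Definition induced_edges : {set {set {x : V | x \in C}}} :=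
  [set e : {set {x : V | x \in C}} | (val @: e)%SET \in edges G]%SET.

Lemma induced_edges_card2 : [forall e in induced_edges, #|e| == 2%N].
Proof.
apply/forall_inP => e; rewrite inE => He.
by rewrite -(card_imset _ val_inj); apply: (forall_inP (edges_card2 G)).
Qed.

Definition induced_subgraph : sgraph {x : V | x \in C} := SGraph induced_edges_card2.

End Induced.

Definition is_component (V : finType) (G : sgraph V) (C : {set V}) : Prop :=
  exists x : V, C = [set y | connect (adj G) x y]%SET.

Definition has_component_iso (V W : finType) (H : sgraph W) (G : sgraph V) :
    Prop :=
  exists2 C : {set V}, is_component G C & isomorphic (induced_subgraph G C) H.

(* Vertices go to distinct points [p x] of the plane and every edge [e] to a
   simple arc [a e], parametrised by the unit interval, joining the images of
   the two ends of [e].  The values of [a e] for [e] not an edge, or outside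
   the unit interval, are irrelevant. *)
Definition plane_drawing (R : realType) (V : finType) (G : sgraph V)
    (p : V -> R * R) (a : {set V} -> R -> R * R) : Prop :=
  [/\ injective p,
      (forall e, e \in edges G ->
        [/\ {within `[0, 1], continuous (a e)},
            {in `[0, 1] &, injective (a e)} &
            [set a e 0; a e 1] = p @` [set` e]]),
      (forall e, e \in edges G ->
        forall t, t \in `]0, 1[ -> forall x, a e t <> p x) &
      (forall e f, e \in edges G -> f \in edges G -> e != f ->
        forall s t, s \in `]0, 1[ -> t \in `]0, 1[ -> a e s <> a f t)].

Definition planar (R : realType) (V : finType) (G : sgraph V) : Prop :=
  exists p a, @plane_drawing R V G p a.

Definition planar_graphs (R : realType) (n m : nat) : {set sgraph 'I_n} :=
  [set G : sgraph 'I_n | (#|edges G| == m) && `[< planar R G >]]%SET.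

(* Equal to 0 when [A] is empty. *)
Definition uniform_pr (R : realType) (T : finType) (A : {set T})
    (Q : T -> Prop) : R :=
  #|[set x in A | `[< Q x >]]%SET|%:R / #|A|%:R.

(* Main.v *)
Require Import Defs.
From mathcomp Require Import all_boot all_order all_algebra.
From mathcomp Require Import all_classical all_reals all_analysis.
From mathcomp Require Import ring lra zify.

Import Order.TTheory GRing.Theory Num.Theory.
Import numFieldNormedType.Exports.

Set Implicit Arguments.
Unset Strict Implicit.
Unset Printing Implicit Defensive.

(* Let k be the number of vertices and h > k the number of edges of H.  Delete
   the edges of a component isomorphic to H, hang its k vertices as pendant
   vertices anywhere on the rest of the graph, and restore the number of edges
   by adding h - k further edges.  The pendant vertices can be placed in about
   n^k ways, which pays for choosing the vertex set of the component; and each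
   further edge can be chosen in far more than n ways, while it is one of only
   O(n) edges of the resulting graph.  Hence graphs with such a component are
   rare.

   A planar graph with at most (1 + o(1)) n edges has superlinearly many
   addable edges for the following reason.  Contract leaves and long paths of
   vertices of degree two.  Two vertices that end up at the same vertex of the
   contracted graph can be joined without losing planarity.  Either the
   contracted graph has many vertices in components with at most four vertices,
   which can be joined to anything outside their component, or it has only o(n)
   vertices, and then many pairs are contracted to a common vertex.

   Faces and the Jordan curve theorem are avoided: every planar modification is
   obtained from a short chord near a point of an arc, and from making the
   drawing radial near a vertex. *)

(** Each contraction removes one vertex and one edge, so the excess of edges over vertices, at most
    o(n), survives to the contracted graph. There, with no leaves left, twice the excess is the sum
    of (degree - 2), up to isolated vertices. Hence little of that sum comes from vertices of degree
    at least three, and a vertex at distance more than two from all of these lies in a tiny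
    component, since long paths are gone as well.

    The obstacle is an edge inside a class: once two vertices of a class are adjacent, later steps
    need a parallel copy of their edge, and faces are not at hand to provide it. Hence the doubling
    clause of the invariant and the chords next to arcs.

    The vertex type never changes. A new vertex is an isolated one that is moved, and a graph with
    fewer vertices is an edge set that avoids some of them.

    In the count the further edges are added before the pendant vertices, while the vertices of the
    component are still isolated. Of the h - k further edges only one needs to gain the factor [L],
    because [L] is an arbitrary constant. *)

Local Open Scope ring_scope.

(** * Simple arcs in the plane *)

Section Arcs.
Local Open Scope classical_set_scope.
Local Open Scope ring_scope.
Variable R : realType.
Notation P := (R * R)%type.

(** Continuity is required on the whole line, so that affine changes of parameter need no subspace
    topology; [clamp] brings an arc given on the unit interval into this form. *)
Definition simple_arc (g : R -> P) (x y : P) :=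
  [/\ continuous g,
      forall s t : R, 0 <= s <= 1 -> 0 <= t <= 1 -> g s = g t -> s = t,
      g 0 = x & g 1 = y].

Definition clamp (t : R) : R := Num.max 0 (Num.min 1 t).

Lemma clamp_in t : 0 <= clamp t <= 1.
Proof.
rewrite /clamp le_max lexx /= ge_max ler01 /= ge_min lexx //.
Qed.

Lemma clamp_id t : 0 <= t <= 1 -> clamp t = t.
Proof. by move=> /andP[t0 t1]; rewrite /clamp (min_idPr t1) (max_idPr t0). Qed.

Lemma clamp_ge1 t : 1 <= t -> clamp t = 1.
Proof. by move=> t1; rewrite /clamp (min_idPl t1) (max_idPr ler01). Qed.

Lemma clamp_le0 t : t <= 0 -> clamp t = 0.
Proof.
by move=> t0; rewrite /clamp (min_idPr (le_trans t0 ler01)) (max_idPl t0).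
Qed.

Lemma clamp_cont : continuous clamp.
Proof.
apply: (@max_fun_continuous _ R R (cst 0) (fun t => Num.min 1 t)).
  by move=> x; apply: cvg_cst.
apply: (@min_fun_continuous _ R R (cst 1) id) => x; first by apply: cvg_cst.
by apply: cvg_id.
Qed.

Lemma continuous_clamp (g : R -> P) :
  {within `[0, 1], continuous g} -> continuous (g \o clamp).
Proof.
move=> cg t.
have ct : `[0, 1]%classic (clamp t) by rewrite /= in_itv /= clamp_in.
move/subspace_continuousP: cg => /(_ _ ct) H A /H /= hA.
have h : nbhs t _ := @clamp_cont t _ hA.
rewrite /=; apply: (@filterS _ (nbhs t) _ _ _ _ h) => s /=; apply.
by rewrite /= in_itv /= clamp_in.
Qed.

Lemma arc_clamp (g : R -> P) :
  {within `[0, 1], continuous g} -> {in `[0, 1] &, injective g} ->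
  simple_arc (g \o clamp) (g 0) (g 1).
Proof.
move=> cg ig; split => /=; first exact: continuous_clamp.
- move=> s t hs ht; rewrite !clamp_id //; apply: ig; by rewrite in_itv.
- by rewrite clamp_id // lexx ler01.
- by rewrite clamp_id // lexx ler01.
Qed.

Lemma affine_cont (a b : R) : continuous (fun t : R => a + b * t).
Proof.
move=> t; apply: cvgD; first exact: cvg_cst.
by apply: cvgM; [exact: cvg_cst | exact: cvg_id].
Qed.

Lemma continuous_affine (g : R -> P) (a b : R) :
  continuous g -> continuous (fun t => g (a + b * t)).
Proof.
by move=> cg t; apply: (continuous_comp (@affine_cont a b t)); exact: cg.
Qed.

Lemma sub_arc (g : R -> P) x y (s t : R) : simple_arc g x y ->
  0 <= s <= 1 -> 0 <= t <= 1 -> s != t ->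
  simple_arc (fun r => g (s + (t - s) * r)) (g s) (g t).
Proof.
move=> [cg ig _ _] s01 t01 st; split.
- exact: continuous_affine.
- move=> r r' hr hr' /ig e; have : (t - s) * (r - r') = 0.
    suff : s + (t - s) * r = s + (t - s) * r' by lra.
    by apply: e; nra.
  by move/eqP; rewrite mulf_eq0 !subr_eq0 eq_sym (negbTE st) => /eqP.
- by rewrite mulr0 addr0.
- by rewrite mulr1 addrC subrK.
Qed.

Lemma rev_arc (g : R -> P) x y : simple_arc g x y -> simple_arc (fun r => g (1 - r)) y x.
Proof.
move=> [cg ig g0 g1]; split.
- rewrite (_ : (fun r => _) = fun r => g (1 + -1 * r)).
    exact: continuous_affine.
  by apply/funext => r; rewrite mulN1r.
- move=> s t hs ht /ig e; suff: 1 - s = 1 - t by lra.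
  by apply: e; lra.
- by rewrite subr0.
- by rewrite subrr.
Qed.

Lemma cat_arc (g h : R -> P) x y z : simple_arc g x y -> simple_arc h y z ->
  (forall s t : R, 0 <= s <= 1 -> 0 <= t <= 1 -> g s = h t -> s = 1 /\ t = 0) ->
  exists2 k, simple_arc k x z & forall t, 0 < t < 1 ->
    [\/ exists2 s, 0 < s < 1 & k t = g s, k t = y |
        exists2 s, 0 < s < 1 & k t = h s].
Proof.
move=> [cg ig g0 g1] [ch ih h0 h1] gh.
(* On each half of the unit interval one of the two clamped terms is constantly [y]. The formula is
   therefore the concatenation, and it is continuous without any gluing. *)
pose k (t : R) : P := g (clamp (2 * t)) + h (clamp (2 * t - 1)) - y.
have kl (t : R) : t <= 1/2 -> k t = g (clamp (2 * t)).
  by move=> t1; rewrite /k (@clamp_le0 (2 * t - 1)) ?h0 ?addrK //; lra.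
have kr (t : R) : 1/2 <= t -> k t = h (clamp (2 * t - 1)).
  by move=> t1; rewrite /k (@clamp_ge1 (2 * t)) ?g1 ?[y + _]addrC ?addrK //; lra.
have cont2 (f : R -> P) (a : R) : continuous f ->
    continuous (fun t : R => f (clamp (2 * t + a))).
  move=> cf; rewrite (_ : (fun t => _) = fun t : R => (f \o clamp) (a + 2 * t)).
    apply: (@continuous_affine (f \o clamp)) => t.
    by apply: continuous_comp; [exact: clamp_cont|exact: cf].
  by apply/funext => t /=; rewrite addrC.
exists k.
  split.
  - move=> t; apply: cvgB; last exact: cvg_cst.
    apply: cvgD; last exact: cont2.
    have -> : (fun t : R => g (clamp (2 * t))) = fun t => g (clamp (2 * t + 0)).
      by apply/funext => r; rewrite addr0.
    by have := cont2 g 0 cg t; rewrite /continuous_at addr0.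
  - have inj (s t : R) : s <= t -> 0 <= s <= 1 -> 0 <= t <= 1 -> k s = k t -> s = t.
      move=> st hs ht.
      case: (lerP t (1/2)) => t2.
        rewrite !kl; [|lra|lra].
        move/ig => e; suff: 2 * s = 2 * t by lra.
        by move: e; rewrite !clamp_id; [apply; lra|lra|lra].
      case: (lerP s (1/2)) => s2.
        rewrite kl // kr; [|lra].
        by rewrite !clamp_id; [|lra|lra] => /gh; case; lra.
      rewrite !kr; [|lra|lra].
      move/ih => e; suff: 2 * s - 1 = 2 * t - 1 by lra.
      by move: e; rewrite !clamp_id; [apply; lra|lra|lra].
    move=> s t hs ht e; case: (lerP s t) => st; first exact: inj.
    by symmetry; apply: inj => //; exact: ltW.
  - by rewrite kl ?clamp_id ?mulr0 //; lra.
  - by rewrite kr ?clamp_id; [rewrite -h1; congr h; lra|lra|lra].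
move=> t t01; case: (ltrgtP t (1/2)) => t2.
- constructor 1; exists (2 * t); first lra.
  by rewrite kl ?clamp_id //; lra.
- constructor 3; exists (2 * t - 1); first lra.
  by rewrite kr ?clamp_id //; lra.
- by constructor 2; rewrite kl ?clamp_id ?t2; [rewrite -g1; congr g; lra|lra|lra].
Qed.

Lemma pair_cont (f1 f2 : R -> R) : continuous f1 -> continuous f2 ->
  continuous (fun t => (f1 t, f2 t) : P).
Proof.
by move=> c1 c2 t; apply: (cvg_pair (c1 t) (c2 t)).
Qed.

Lemma arc_image_closed (g : R -> P) (a b : R) :
  continuous g -> closed (g @` `[a, b]).
Proof.
move=> cg; apply: compact_closed; first exact: norm_hausdorff.
apply: continuous_compact; last exact: segment_compact.
exact: continuous_subspaceT.
Qed.

Lemma first_hit (h : R -> P) (F : set P) (t0 : R) : continuous h -> closed F ->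
  ~ F (h 0) -> 0 <= t0 <= 1 -> F (h t0) ->
  exists t, [/\ 0 < t <= 1, F (h t) & forall s, 0 <= s < t -> ~ F (h s)].
Proof.
move=> ch cF nF0 t01 Ft.
pose A : set R := `[0, 1]%classic `&` h @^-1` F.
have cA : compact A.
  apply: compact_closedI; first exact: segment_compact.
  by apply: preimage_closed => // x _; exact: ch.
have [||c] := @compact_EVT_min R R id A _ cA.
- by exists t0; split => //=; rewrite in_itv.
- by apply: continuous_subspaceT => x; exact: cvg_id.
rewrite inE => -[/=]; rewrite in_itv /= => c01 Fc cmin; exists c; split => //.
- rewrite lt_neqAle; case/andP: c01 => -> ->; rewrite !andbT.
  by apply/eqP => e; apply: nF0; rewrite e.
- move=> s sc Fs; have : c <= s.
    apply: cmin; rewrite inE; split => //=; rewrite in_itv /=; lra.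
  lra.
Qed.
End Arcs.

(** * A chord next to an arc *)

Section NearChord.
Local Open Scope classical_set_scope.
Local Open Scope ring_scope.
Variable R : realType.
Notation P := (R * R)%type.

Lemma ballP2 (q z : P) (e : R) :
  ball q e z <-> `|q.1 - z.1| < e /\ `|q.2 - z.2| < e.
Proof. by rewrite /ball /= /prod_ball -!ball_normE. Qed.

(** If [S] missed [g j], the preimages under [S] of the two halves of the arc would split the unit
    interval into two disjoint closed sets, one containing 0 and the other 1. *)
Lemma path_meets_middle (g S : R -> P) (i j k : R) :
  continuous g -> continuous S ->
  (forall s t : R, 0 <= s <= 1 -> 0 <= t <= 1 -> g s = g t -> s = t) ->
  0 <= i -> i < j -> j < k -> k <= 1 -> S 0 = g i -> S 1 = g k ->
  (forall l, 0 <= l <= 1 -> exists2 r, 0 <= r <= 1 & S l = g r) ->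
  exists2 l, 0 <= l <= 1 & S l = g j.
Proof.
move=> cg cS ig i0 ij jk k1 S0 S1 Sg; apply: contrapT => nj.
pose C1 : set R := S @^-1` (g @` `[0, j]).
pose C2 : set R := S @^-1` (g @` `[j, 1]).
have cl (a b : R) : closed (S @^-1` (g @` `[a, b])).
  by apply: preimage_closed => [x _|]; [exact: cS|exact: arc_image_closed].
have C12 : `[0, 1] `&` C1 = `[0, 1] `&` ~` C2.
  apply/seteqP; split => l [/= l01]; rewrite in_itv /= in l01.
    move=> [r /=]; rewrite in_itv /= => /andP[r0 rj] e1.
    split => //= -[r']; rewrite /= !in_itv /= => /andP[r'j r'1] e2.
    have e : r = r' by apply: ig; rewrite ?e1 ?e2 //; lra.
    by apply: nj; exists l => //; rewrite -e1; congr g; lra.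
  move=> n2; split => //; have [r r01 e] := Sg l l01.
  case: (lerP r j) => rj; first by exists r => //=; rewrite in_itv /=; lra.
  by case: n2; exists r => //=; rewrite in_itv /=; lra.
have h0 : `[0, 1]%classic (0 : R) by rewrite /= in_itv /=; lra.
have h1 : `[0, 1]%classic (1 : R) by rewrite /= in_itv /=; lra.
have e : `[0, 1] `&` C1 = `[0, 1]%classic.
  apply: (@segment_connected R 0 1).
  - exists 0; split => //; exists i => //=; rewrite in_itv /=; lra.
  - by exists (~` C2) => //; apply: closed_openC; exact: cl.
  - by exists C1 => //; exact: cl.
move: h1; rewrite -e C12 => -[_]; apply; exists k => //=.
by rewrite in_itv /=; lra.
Qed.

Section Frame.
Variables (q d : P).
Hypothesis d0 : d != 0.

(** Coordinates with origin [q] along [d] and along [d] rotated by a right angle. *)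
Let pt (x y : R) : P := (q.1 + x * d.1 - y * d.2, q.2 + x * d.2 + y * d.1).

Lemma frame_inj x y x' y' : pt x y = pt x' y' -> x = x' /\ y = y'.
Proof.
move=> [e1 e2].
have dd : 0 < d.1 ^+ 2 + d.2 ^+ 2.
  rewrite lt_neqAle addr_ge0 ?sqr_ge0 // andbT eq_sym paddr_eq0 ?sqr_ge0 //.
  rewrite !sqrf_eq0; apply: contra d0 => /andP[/eqP a /eqP b].
  by rewrite [d]surjective_pairing a b.
have f1 : (x - x') * d.1 - (y - y') * d.2 = 0 by lra.
have f2 : (x - x') * d.2 + (y - y') * d.1 = 0 by lra.
have h1 : (x - x') * (d.1 ^+ 2 + d.2 ^+ 2) = 0.
  rewrite (_ : _ * _ = d.1 * ((x - x') * d.1 - (y - y') * d.2) +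
    d.2 * ((x - x') * d.2 + (y - y') * d.1)); last by ring.
  by rewrite f1 f2 !mulr0 addr0.
have h2 : (y - y') * (d.1 ^+ 2 + d.2 ^+ 2) = 0.
  rewrite (_ : _ * _ = d.1 * ((x - x') * d.2 + (y - y') * d.1) -
    d.2 * ((x - x') * d.1 - (y - y') * d.2)); last by ring.
  by rewrite f1 f2 !mulr0 subr0.
move/eqP: h1; move/eqP: h2; rewrite !mulf_eq0 !(gt_eqF dd) !orbF !subr_eq0.
by move=> /eqP -> /eqP ->.
Qed.

Lemma frame_ball (e x y : R) : ball q (e / 2) (q + d) ->
  0 <= x -> 0 <= y -> x + y <= 1 -> ball q e (pt x y).
Proof.
move=> /ballP2 /= [b1 b2] x0 y0 xy; apply/ballP2 => /=.
have a1 : `|d.1| < e / 2 by rewrite -normrN; congr (`|_| < _): b1; ring.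
have a2 : `|d.2| < e / 2 by rewrite -normrN; congr (`|_| < _): b2; ring.
have bound (u v : R) : `|u| < e / 2 -> `|v| < e / 2 -> `|x * u + y * v| < e.
  move=> hu hv; apply: (le_lt_trans (ler_normD _ _)).
  rewrite !normrM (ger0_norm x0) (ger0_norm y0).
  have nu := normr_ge0 u; have nv := normr_ge0 v; nra.
split.
  rewrite (_ : _ - _ = x * (- d.1) + y * d.2); last by ring.
  by apply: bound; rewrite ?normrN.
rewrite (_ : _ - _ = x * (- d.2) + y * (- d.1)); last by ring.
by apply: bound; rewrite ?normrN.
Qed.

Lemma frame_cont (a b a' b' : R) :
  continuous (fun t : R => pt (a + b * t) (a' + b' * t)).
Proof.
rewrite (_ : (fun t : R => _) = fun t : R =>
  ((pt a a').1 + (b * d.1 - b' * d.2) * t,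
   (pt a a').2 + (b * d.2 + b' * d.1) * t)); last first.
  by apply/funext => t; rewrite /pt /=; congr (_, _); ring.
by apply: pair_cont; exact: affine_cont.
Qed.

(* An arc has empty interior: among three non-collinear points of it the one
   with the middle parameter would have to lie on the segment joining the
   other two. *)
Lemma frame_off_arc (g : R -> P) : continuous g ->
  (forall s t : R, 0 <= s <= 1 -> 0 <= t <= 1 -> g s = g t -> s = t) ->
  exists x y, [/\ 0 <= x, 0 < y, x + y <= 1 &
    forall u, 0 <= u <= 1 -> pt x y <> g u].
Proof.
move=> cg ig; apply: contrapT => no.
have on x y : 0 <= x -> 0 < y -> x + y <= 1 ->
    exists2 u, 0 <= u <= 1 & pt x y = g u.
  move=> x0 y0 xy; apply: contrapT => nu; apply: no; exists x, y; split => //.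
  by move=> u u01 e; apply: nu; exists u.
(* Three non-collinear points with positive second coordinate: the segments between them stay in the
   region that the arc is assumed to cover. The six orders of their parameters are treated alike. *)
have [||| r1 r101 e1] := on 0 1; [lra|lra|lra|].
have [||| r2 r201 e2] := on 0 (1 / 2); [lra|lra|lra|].
have [||| r3 r301 e3] := on (1 / 2) (1 / 2); [lra|lra|lra|].
have mid (x y x' y' x'' y'' i j k : R) :
    pt x y = g i -> pt x' y' = g j -> pt x'' y'' = g k -> 0 <= x -> 0 < y -> x + y <= 1 ->
    0 <= x'' -> 0 < y'' -> x'' + y'' <= 1 ->
    0 <= i -> i < j -> j < k -> k <= 1 ->
    exists2 l, 0 <= l <= 1 &
      x' = (1 - l) * x + l * x'' /\ y' = (1 - l) * y + l * y''.
  move=> ei ej ek x0 y0 xy x0'' y0'' xy'' i0 ij jk k1.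
  have [||| l l01 el] := path_meets_middle cg
    (@frame_cont x (x'' - x) y (y'' - y)) ig i0 ij jk k1.
  - by rewrite !mulr0 !addr0.
  - by rewrite !mulr1 ![_ + (_ - _)]addrC !subrK.
  - by move=> l l01; apply: on; nra.
  exists l => //; move: el; rewrite -ej => /frame_inj[<- <-].
  by split; ring.
have n12 : r1 != r2.
  by apply/eqP => e; move: e1; rewrite e -e2 => /frame_inj[? ?]; lra.
have n13 : r1 != r3.
  by apply/eqP => e; move: e1; rewrite e -e3 => /frame_inj[? ?]; lra.
have n23 : r2 != r3.
  by apply/eqP => e; move: e2; rewrite e -e3 => /frame_inj[? ?]; lra.
case: (ltgtP r1 r2) n12 => // l12 _; case: (ltgtP r1 r3) n13 => // l13 _;
  case: (ltgtP r2 r3) n23 => // l23 _;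
  try by clear -l12 l13 l23; lra.
- have [||||||||||l l01 [h1 h2]] := mid _ _ _ _ _ _ _ _ _ e1 e2 e3;
    first [by clear -l01 h1 h2; lra|by clear -r101 r201 r301 l12 l13 l23; lra].
- have [||||||||||l l01 [h1 h2]] := mid _ _ _ _ _ _ _ _ _ e1 e3 e2;
    first [by clear -l01 h1 h2; lra|by clear -r101 r201 r301 l12 l13 l23; lra].
- have [||||||||||l l01 [h1 h2]] := mid _ _ _ _ _ _ _ _ _ e3 e1 e2;
    first [by clear -l01 h1 h2; lra|by clear -r101 r201 r301 l12 l13 l23; lra].
- have [||||||||||l l01 [h1 h2]] := mid _ _ _ _ _ _ _ _ _ e2 e1 e3;
    first [by clear -l01 h1 h2; lra|by clear -r101 r201 r301 l12 l13 l23; lra].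
- have [||||||||||l l01 [h1 h2]] := mid _ _ _ _ _ _ _ _ _ e2 e3 e1;
    first [by clear -l01 h1 h2; lra|by clear -r101 r201 r301 l12 l13 l23; lra].
- have [||||||||||l l01 [h1 h2]] := mid _ _ _ _ _ _ _ _ _ e3 e2 e1;
    first [by clear -l01 h1 h2; lra|by clear -r101 r201 r301 l12 l13 l23; lra].
Qed.

End Frame.
(* Vertices of degree two can slide along an arc, so a chord this short serves
   instead of a parallel copy of the whole arc. *)
Lemma near_chord (g : R -> P) (F : set P) x y : simple_arc g x y -> closed F ->
  ~ F (g (1 / 2)) -> F x -> F y ->
  exists s t k, [/\ 0 < s, s < t, t < 1, simple_arc k (g s) (g t) &
    forall r, 0 < r < 1 -> ~ F (k r) /\ forall u, 0 <= u <= 1 -> k r <> g u].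
Proof.
move=> [cg ig g0 g1] cF nF Fx Fy.
pose q : P := g (1 / 2).
have [e e0 qF] : exists2 e : R, 0 < e & ball q e `<=` ~` F.
  by have := closed_openC cF; rewrite openE => /(_ q nF) /nbhs_ballP[e]; exists e.
have [t2 t201 t2b] : exists2 t2, 1 / 2 < t2 < 1 & ball q (e / 2) (g t2).
  have : nbhs (1 / 2 : R) (g @^-1` ball q (e / 2)).
    by apply: (cg (1 / 2)); apply: nbhsx_ballx; lra.
  move/nbhs_ballP => [h /= h0 hb].
  pose m := Num.min (h / 2) (1 / 4).
  have m0 : 0 < m by rewrite lt_min; lra.
  have mh : m < h by rewrite gt_min; lra.
  have m4 : m <= 1 / 4 by rewrite ge_min lexx orbT.
  exists (1 / 2 + m); first lra.
  apply: hb; rewrite -ball_normE /= opprD addNKr normrN gtr0_norm //.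
pose d : P := g t2 - q.
have d0 : d != 0.
  rewrite subr_eq0; apply/eqP => E0.
  have E : t2 = 1 / 2 by apply: ig => //; lra.
  by move: t201; rewrite E ltxx.
have qd : q + d = g t2 by rewrite addrC subrK.
pose pt (x y : R) : P := (q.1 + x * d.1 - y * d.2, q.2 + x * d.2 + y * d.1).
have ptb a b : 0 <= a -> 0 <= b -> a + b <= 1 -> ball q e (pt a b).
  by apply: frame_ball; rewrite qd.
have ptI a b a' b' : pt a b = pt a' b' -> a = a' /\ b = b' by apply: frame_inj.
have ptc (a b a' b' : R) : continuous (fun t : R => pt (a + b * t) (a' + b' * t)).
  exact: frame_cont.
have [x0 [y0 [x00 y00 xy0 off]]] := @frame_off_arc q d d0 g cg ig.
rewrite -/(pt x0 y0) in off.
pose G := g @` `[0, 1].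
have cG : closed G by exact: arc_image_closed.
(* From the point off the arc one segment runs to [q] and another to [g t2], both on the arc. Each
   is cut at its first meeting with the arc, and the two pieces together form the chord. They stay
   in a ball that avoids [F]. *)
have [|||l [l01 [s' /= s01 es] lmin]] := @first_hit _
  (fun t => pt (x0 + (- x0) * t) (y0 + (- y0) * t)) G 1 (ptc _ _ _ _) cG.
- rewrite !mulr0 !addr0 => -[u /=]; rewrite in_itv /= => u01 eu.
  exact: (off u).
- by rewrite ler01 lexx.
- exists (1 / 2) => /=; first by rewrite in_itv /=; lra.
  by rewrite -/q /pt !mulr1 !subrr !mul0r !addr0 !subr0; case: (q).
have [|||m [m01 [t' /= t01 et] mmin]] := @first_hit _
  (fun t => pt (x0 + (1 - x0) * t) (y0 + (- y0) * t)) G 1 (ptc _ _ _ _) cG.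
- rewrite !mulr0 !addr0 => -[u /=]; rewrite in_itv /= => u01 eu.
  exact: (off u).
- by rewrite ler01 lexx.
- exists t2 => /=; first by rewrite in_itv /=; lra.
  rewrite -qd /pt !mulr1 subrr !mul0r subr0 addr0 [x0 + _]addrC subrK !mul1r.
  by case: (q); case: (d).
rewrite in_itv /= in s01; rewrite in_itv /= in t01.
have bl r : 0 <= r <= 1 -> ball q e (pt (x0 + - x0 * r) (y0 + - y0 * r)).
  by move=> r01; apply: ptb; nra.
have bm r : 0 <= r <= 1 -> ball q e (pt (x0 + (1 - x0) * r) (y0 + - y0 * r)).
  by move=> r01; apply: ptb; nra.
have al : simple_arc (fun r => pt (x0 + - x0 * (l - l * r)) (y0 + - y0 * (l - l * r)))
    (g s') (pt x0 y0).
  split.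
  - rewrite (_ : (fun r : R => _) = fun r : R =>
      pt ((x0 - x0 * l) + (x0 * l) * r) ((y0 - y0 * l) + (y0 * l) * r)); first exact: ptc.
    by apply/funext => r; congr (pt _ _); ring.
  - move=> s t hs ht /ptI[_ E].
    have : y0 * l * (s - t) = 0 by lra.
    move/eqP; rewrite !mulf_eq0 subr_eq0 => /orP[/orP[]|] /eqP //; lra.
  - by rewrite mulr0 subr0 -es.
  - by rewrite mulr1 subrr !mulr0 !addr0.
have am : simple_arc (fun r => pt (x0 + (1 - x0) * (m * r)) (y0 + - y0 * (m * r)))
    (pt x0 y0) (g t').
  split.
  - rewrite (_ : (fun r : R => _) = fun r : R =>
      pt (x0 + ((1 - x0) * m) * r) (y0 + (- y0 * m) * r)); first exact: ptc.
    by apply/funext => r; congr (pt _ _); ring.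
  - move=> s t hs ht /ptI[_ E].
    have : y0 * m * (s - t) = 0 by lra.
    move/eqP; rewrite !mulf_eq0 subr_eq0 => /orP[/orP[]|] /eqP //; lra.
  - by rewrite !mulr0 !addr0.
  - by rewrite mulr1 -et.
have [] := cat_arc al am.
  move=> s t hs ht /ptI[E1 E2].
  have : y0 * ((l - l * s) - m * t) = 0 by lra.
  move/eqP; rewrite mulf_eq0 subr_eq0 => /orP[/eqP|/eqP E3]; first lra.
  have mt : m * t = 0 by rewrite E3 in E1; lra.
  split.
    have : l * (1 - s) = 0 by lra.
    by move/eqP; rewrite mulf_eq0 subr_eq0 => /orP[/eqP|/eqP]; lra.
  by move/eqP: mt; rewrite mulf_eq0 => /orP[/eqP|/eqP]; lra.
move=> k ak kP.
have kF r : 0 < r < 1 -> ~ F (k r) /\ forall u, 0 <= u <= 1 -> k r <> g u.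
  move=> /kP[[s hs ->]|->|[s hs ->]].
  - split; first by apply: qF; apply: bl; nra.
    move=> u u01 E; apply: (lmin (l - l * s)); first nra.
    by exists u => //=; rewrite in_itv.
  - split; first by apply: qF; apply: ptb; lra.
    exact: off.
  - split; first by apply: qF; apply: bm; nra.
    move=> u u01 E; apply: (mmin (m * s)); first nra.
    by exists u => //=; rewrite in_itv.
have st : s' != t'.
  apply/eqP => E; move: es; rewrite E et => /ptI[E1 E2].
  have : y0 * (l - m) = 0 by lra.
  move/eqP; rewrite mulf_eq0 subr_eq0 (gt_eqF y00) => /eqP lm.
  have m0 : m = 0 by rewrite lm in E1; lra.
  by move: m01; rewrite m0 ltxx.
have endF u : 0 <= u <= 1 -> ball q e (g u) -> 0 < u < 1.
  move=> u01 b; have nu := qF _ b.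
  have u0 : u != 0 by apply/eqP => u0; apply: nu; rewrite /= u0 g0.
  have u1 : u != 1 by apply/eqP => u1; apply: nu; rewrite /= u1 g1.
  by rewrite !lt_neqAle eq_sym u0 u1.
have s'01 : 0 < s' < 1 by apply: endF => //; rewrite es; apply: bl; lra.
have t'01 : 0 < t' < 1 by apply: endF => //; rewrite et; apply: bm; lra.
case: (ltgtP s' t') st => // lt _.
  by exists s', t', k; split; [lra|exact: lt|lra|exact: ak|exact: kF].
exists t', s', (fun r => k (1 - r)).
split; [lra|exact: lt|lra|exact: rev_arc|].
by move=> r r01; apply: kF; lra.
Qed.

End NearChord.

(** * Drawings by arcs *)

Section Drawings.
Local Open Scope classical_set_scope.
Local Open Scope ring_scope.
Variables (R : realType) (V : finType).
Notation P := (R * R)%type.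
Implicit Types (E : {set {set V}}) (p : V -> P) (a : {set V} -> R -> P).

(** Stated for arbitrary sets of vertex sets, so that edges are added and removed without proving
    anything about their size; that an edge has two ends follows from the injectivity of its arc. *)
Definition arc_drawing E p a : Prop :=
  [/\ injective p,
      forall e, e \in E -> exists u v, e = [set u; v]%SET /\ simple_arc (a e) (p u) (p v),
      forall e, e \in E -> forall t : R, 0 < t < 1 -> forall x, a e t <> p x &
      forall e f, e \in E -> f \in E -> e != f ->
        forall s t : R, 0 < s < 1 -> 0 < t < 1 -> a e s <> a f t].

Definition drawable E : Prop := exists p a, arc_drawing E p a.

(** Such a vertex serves as a new vertex: it can be moved to any point off the drawing. *)
Definition isolated_in E (w : V) : Prop := forall e, e \in E -> w \notin e.

Definition off_drawing E p a (q : P) : Prop := (forall x, q <> p x) /\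
  forall f, f \in E -> forall s : R, 0 < s < 1 -> q <> a f s.

Lemma open01W (t : R) : 0 < t < 1 -> 0 <= t <= 1.
Proof. lra. Qed.

Lemma set2P_or (x y u v : V) : [set x; y]%SET = [set u; v]%SET ->
  (x = u /\ y = v) \/ (x = v /\ y = u).
Proof.
move=> e; have: x \in [set u; v]%SET by rewrite -e !inE eqxx.
have: y \in [set u; v]%SET by rewrite -e !inE eqxx orbT.
have: u \in [set x; y]%SET by rewrite e !inE eqxx.
have: v \in [set x; y]%SET by rewrite e !inE eqxx orbT.
rewrite !inE => /orP[]/eqP ? /orP[]/eqP ? /orP[]/eqP ? /orP[]/eqP ?; subst;
  by [left|right].
Qed.

Lemma drawable_sedges (G : sgraph V) : planar R G <-> drawable (edges G).
Proof.
split=> -[p [a]].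
  case=> ip arcs av aa; exists p, (fun e => a e \o @clamp R); split => //.
  - move=> e eE; have [ce ie ends] := arcs e eE.
    have [x xe a0] : (p @` [set` e]) (a e 0) by rewrite -ends; left.
    have [y ye a1] : (p @` [set` e]) (a e 1) by rewrite -ends; right.
    exists x, y; split; last by rewrite a0 a1; exact: arc_clamp.
    have xy : x != y.
      apply/eqP => xy; have : (0 : R) = 1.
        by apply: ie; rewrite ?in_itv /= ?lexx ?ler01 // -a0 -a1 xy.
      by move/eqP; rewrite eq_sym oner_eq0.
    apply/eqP; rewrite eq_sym eqEcard cards2 xy.
    rewrite (eqP (forall_inP (edges_card2 G) _ eE)) andbT.
    by apply/fintype.subsetP => z; rewrite !inE => /orP[]/eqP ->.
  - move=> e eE t t01 x; rewrite /= clamp_id ?open01W //.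
    by apply: av => //; rewrite in_itv.
  - move=> e f eE fE ef s t s01 t01; rewrite /= !clamp_id ?open01W //.
    by apply: aa => //; rewrite in_itv.
case=> ip arcs av aa; exists p, a; split => //.
- move=> e eE; have [u [v [-> [ca ia a0 a1]]]] := arcs e eE; split.
  + exact: continuous_subspaceT.
  + by move=> s t; rewrite !in_itv /=; exact: ia.
  + rewrite a0 a1; apply/seteqP; split => z.
      by move=> [->|->]; [exists u|exists v]; rewrite //= !inE eqxx ?orbT.
    by move=> [x /=]; rewrite !inE => /orP[]/eqP -> <-; [left|right].
Qed.

Lemma drawing_pair E p a e : arc_drawing E p a -> e \in E -> #|e| = 2.
Proof.
move=> [ip arcs _ _] /arcs[u [v [-> [_ ia a0 a1]]]]; rewrite cards2.
case: eqVneq => // uv; have : (0 : R) = 1.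
  by apply: ia; rewrite ?lexx ?ler01 // a0 a1 uv.
by move/eqP; rewrite eq_sym oner_eq0.
Qed.

Lemma drawing_neq E p a x y : arc_drawing E p a -> [set x; y]%SET \in E -> x != y.
Proof. by move=> D /(drawing_pair D); rewrite cards2; case: eqVneq. Qed.

Lemma drawing_sub E E' p a : E' \subset E -> arc_drawing E p a -> arc_drawing E' p a.
Proof.
move=> /fintype.subsetP sub [ip arcs av aa]; split => //.
- by move=> e /sub; exact: arcs.
- by move=> e /sub; exact: av.
- by move=> e f /sub eE /sub; exact: aa.
Qed.

Lemma drawable_sub E E' : E' \subset E -> drawable E -> drawable E'.
Proof. by move=> sub [p [a D]]; exists p, a; exact: drawing_sub D. Qed.

Lemma free_sub E E' p a q : E' \subset E -> off_drawing E p a q -> off_drawing E' p a q.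
Proof. by move=> /fintype.subsetP sub [h1 h2]; split => // f /sub; exact: h2. Qed.

(** The stored arc of an unordered pair may run either way; here it is oriented, by reversal if
    necessary. *)
Lemma drawing_edge E p a x y : arc_drawing E p a -> [set x; y]%SET \in E ->
  exists2 g, simple_arc g (p x) (p y) & forall t : R, 0 < t < 1 ->
    exists2 s, 0 < s < 1 & g t = a [set x; y]%SET s.
Proof.
move=> [ip arcs _ _] /[dup] xyE /arcs[u [v [/set2P_or e ar]]].
case: e ar => -[-> ->] ar.
  by exists (a [set u; v]%SET) => // t t01; exists t.
exists (fun r => a [set v; u]%SET (1 - r)); first exact: rev_arc.
by move=> t t01; exists (1 - t) => //; lra.
Qed.

Definition upd (T : eqType) U (f : T -> U) (w : T) (q : U) :=
  fun x => if x == w then q else f x.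

Lemma upd_id (T : eqType) U (f : T -> U) w q : upd f w q w = q.
Proof. by rewrite /upd eqxx. Qed.

Lemma upd_ne (T : eqType) U (f : T -> U) w q x : x != w -> upd f w q x = f x.
Proof. by rewrite /upd => /negbTE ->. Qed.

Lemma drawing_move E p a w q : arc_drawing E p a -> isolated_in E w ->
  off_drawing E p a q -> arc_drawing E (upd p w q) a.
Proof.
move=> [ip arcs av aa] iw [q1 q2]; split => //.
- move=> x y; rewrite /upd; case: eqVneq => [->|xw]; case: eqVneq => [->|yw] //.
  + by move/q1.
  + by move/esym/q1.
  + exact: ip.
- move=> e /[dup] /iw we /arcs[u [v [e_ ar]]]; exists u, v; split => //.
  rewrite e_ !inE negb_or in we; case/andP: we => uw vw.
  by rewrite !upd_ne // eq_sym.
- move=> e eE t t01 x; rewrite /upd; case: eqVneq => [_|_]; last exact: av.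
  by move/esym; exact: q2.
Qed.

Lemma free_move E p a w q z :
  off_drawing E p a z -> z <> q -> off_drawing E (upd p w q) a z.
Proof. by move=> [h1 h2] zq; split => // x; rewrite /upd; case: ifP. Qed.

Lemma drawing_add E p a x y g : arc_drawing E p a -> simple_arc g (p x) (p y) ->
  (forall t : R, 0 < t < 1 -> off_drawing E p a (g t)) ->
  arc_drawing ([set x; y]%SET |: E) p (upd a [set x; y]%SET g).
Proof.
move=> [ip arcs av aa] ag fr; split => //.
- move=> e; rewrite !inE /upd; case: eqVneq => [-> _|_ /=]; last exact: arcs.
  by exists x, y.
- move=> e; rewrite !inE /upd; case: eqVneq => [-> _|_ /=]; last exact: av.
  by move=> t /fr[].
- move=> e f; rewrite !inE /upd; case: eqVneq => [-> _|_ /= eE];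
    case: eqVneq => [-> _|_ /= fE] //.
  + by move=> _ s t /fr[_ h] t01; exact: h.
  + by move=> _ s t s01 /fr[_ h] /esym; exact: h.
  + exact: aa.
Qed.

Lemma free_add E p a x y g z : off_drawing E p a z ->
  (forall s : R, 0 < s < 1 -> z <> g s) ->
  off_drawing ([set x; y]%SET |: E) p (upd a [set x; y]%SET g) z.
Proof.
move=> [h1 h2] zg; split => // f; rewrite !inE /upd.
by case: eqVneq => [_ _|_ /=]; [exact: zg|exact: h2].
Qed.

Lemma partial_drawing_closed E p a (A : set V) : arc_drawing E p a ->
  closed (p @` A `|` \bigcup_(f in [set` E]) (a f @` `[0, 1])).
Proof.
move=> [_ arcs _ _]; apply: closedU.
  apply: compact_closed; first exact: norm_hausdorff.
  by apply: finite_compact; apply: finite_image; exact: finite_finset.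
apply: closed_bigcup; first exact: finite_finset.
by move=> f /= /arcs[u [v [_ [ca _ _ _]]]]; exact: arc_image_closed.
Qed.

Lemma free_closed E p a : arc_drawing E p a -> closed (~` [set q | off_drawing E p a q]).
Proof.
move=> D; have [_ arcs av _] := D.
rewrite (_ : ~` _ = range p `|` \bigcup_(f in [set` E]) (a f @` `[0, 1])).
  exact: partial_drawing_closed.
apply/seteqP; split => q /=.
  move=> nf; apply: contrapT => h; apply: nf; split.
    by move=> x qx; apply: h; left; exists x.
  move=> f fE s s01 e; apply: h; right; exists f => //; exists s => //=.
  by rewrite in_itv /= open01W.
case=> [[x _ <-] [h _]|[f /= fE [s]]]; first exact: (h x).
rewrite /= in_itv /= => s01 <- [h1 h2].
have [u [v [_ [_ _ a0 a1]]]] := arcs f fE.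
have [s0|s0] := eqVneq s 0; first by apply: (h1 u); rewrite s0.
have [s1|s1] := eqVneq s 1; first by apply: (h1 v); rewrite s1.
by apply: (h2 f fE s) => //; rewrite !lt_neqAle eq_sym s0 s1.
Qed.

Lemma edge_free E p a x y (g : R -> P) : arc_drawing E p a ->
  [set x; y]%SET \in E ->
  (forall t : R, 0 < t < 1 -> exists2 s, 0 < s < 1 & g t = a [set x; y]%SET s) ->
  forall t : R, 0 < t < 1 -> off_drawing (E :\ [set x; y]%SET) p a (g t).
Proof.
move=> [ip arcs av aa] xyE ga t /ga[s s01 ->]; split; first exact: av.
by move=> f; rewrite !inE => /andP[fe fE] s' s'01; apply: aa; rewrite // eq_sym.
Qed.

Lemma isolated_sub E E' w : E' \subset E -> isolated_in E w -> isolated_in E' w.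
Proof. by move=> /fintype.subsetP sub iw e /sub; exact: iw. Qed.

Lemma isolated_neq E w x y : isolated_in E w -> [set x; y]%SET \in E ->
  x != w /\ y != w.
Proof.
by move=> iw /iw; rewrite !inE negb_or ![w == _]eq_sym => /andP.
Qed.

Lemma free_sub_arc E p a (g : R -> P) (i j : R) : i < j ->
  (forall r : R, i < r < j -> off_drawing E p a (g r)) ->
  forall r : R, 0 < r < 1 -> off_drawing E p a (g (i + (j - i) * r)).
Proof. by move=> ij fr r r01; apply: fr; nra. Qed.

Lemma off_sub_arc (g : R -> P) x y (i j r : R) : simple_arc g x y ->
  0 <= i -> i < j -> j <= 1 -> 0 <= r <= 1 -> ~~ (i < r < j) ->
  forall s : R, 0 < s < 1 -> g r <> g (i + (j - i) * s).
Proof.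
move=> [_ ig _ _] i0 ij j1 r01 nr s s01 /ig e; move/negP: nr; apply.
rewrite e //; nra.
Qed.

(** The isolated vertex moves to the parameter 1/2 of the arc, whose two halves become the new
    edges. *)
Lemma drawable_subdivide E u v w : drawable E -> [set u; v]%SET \in E ->
  isolated_in E w ->
  drawable ([set u; w] |: ([set w; v] |: (E :\ [set u; v])))%SET.
Proof.
move=> [p [a D]] uvE iw; have [uw vw] := isolated_neq iw uvE.
have [g ag ga] := drawing_edge D uvE; have fr := edge_free D uvE ga.
have sub : (E :\ [set u; v])%SET \subset E by exact: subD1set.
have D0 := drawing_sub sub D.
have h01 : 0 < (1 / 2 : R) < 1 by lra.
have D1 := drawing_move D0 (isolated_sub sub iw) (fr _ h01).
have fr1 (r : R) : 0 < r < 1 -> r != 1 / 2 ->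
    off_drawing (E :\ [set u; v])%SET (upd p w (g (1 / 2))) a (g r).
  move=> r01 r2; apply: free_move; first exact: fr.
  by case: ag => _ ig _ _ /ig e; move/eqP: r2; apply; apply: e; lra.
have [_ _ gu gv] := ag.
have D2 : arc_drawing _ _ _ := @drawing_add _ _ _ w v
  (fun r => g (1 / 2 + (1 - 1 / 2) * r)) D1 _ _.
have {}D2 := D2 _ _.
eexists; eexists; apply: (drawing_add (g := fun r => g (0 + (1 / 2 - 0) * r))).
- apply: D2.
  + by rewrite upd_id upd_ne // -gv; apply: (sub_arc ag); lra.
  + apply: free_sub_arc; first lra.
    by move=> r r01; apply: fr1; [|apply/eqP]; lra.
- by rewrite upd_id upd_ne // -gu; apply: (sub_arc ag); lra.
- apply: free_sub_arc; first lra.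
  move=> r r01; apply: free_add; first by apply: fr1; [|apply/eqP]; lra.
  by apply: (off_sub_arc ag); lra.
Qed.
End Drawings.

(** * Triangles on an edge, and smoothing a vertex of degree two *)

Section Ops.
Local Open Scope classical_set_scope.
Local Open Scope ring_scope.
Variables (R : realType) (V : finType).
Notation P := (R * R)%type.
Implicit Types (E : {set {set V}}) (p : V -> P) (a : {set V} -> R -> P).

(** The second conclusion keeps the remaining points of the same arc free, so that several
    consecutive pieces can be added in turn. *)
Lemma drawing_add_piece E p a g x y u v (i j : R) :
  arc_drawing E p a -> simple_arc g x y -> 0 <= i -> i < j -> j <= 1 ->
  p u = g i -> p v = g j -> (forall r, i < r < j -> off_drawing E p a (g r)) ->
  let a' := upd a [set u; v]%SET (fun r => g (i + (j - i) * r)) in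
  arc_drawing ([set u; v]%SET |: E) p a' /\
  forall z, off_drawing E p a z -> (forall r, i < r < j -> z <> g r) ->
    off_drawing ([set u; v]%SET |: E) p a' z.
Proof.
move=> D ag i0 ij j1 pu pv fr; split.
  apply: drawing_add D _ _; last exact: free_sub_arc.
  by rewrite pu pv; apply: (sub_arc ag); [lra|lra|rewrite lt_eqF].
move=> z fz zg; apply: free_add => // s s01; apply: zg; nra.
Qed.

(** [w1] and [w3] go to the ends of a short chord of the arc, and [w2] to the arc between them. The
    chord becomes the edge between [w1] and [w3], and the arc is cut into the four other edges. *)
Lemma drawable_triangle_on_edge E u v w1 w2 w3 : drawable R E ->
  [set u; v]%SET \in E ->
  isolated_in E w1 -> isolated_in E w2 -> isolated_in E w3 ->
  w1 != w2 -> w2 != w3 -> w1 != w3 ->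
  drawable R ([set u; w1] |: ([set w1; w2] |: ([set w2; w3] |: ([set w3; v] |:
    ([set w1; w3] |: (E :\ [set u; v]))))))%SET.
Proof.
move=> [p [a D]] uvE i1 i2 i3 n12 n23 n13.
have [g ag ga] := drawing_edge D uvE; have fr := edge_free D uvE ga.
pose E0 := (E :\ [set u; v])%SET.
have sub : E0 \subset E by exact: subD1set.
have D0 := drawing_sub sub D.
have h01 : 0 < (1 / 2 : R) < 1 by lra.
have [|||s [t [k [s0 st t1 ak kP]]]] := near_chord ag (free_closed D0).
- by apply; exact: fr.
- by case=> /(_ u).
- by case=> /(_ v).
have [_ ig gu gv] := ag.
have gI (r r' : R) : 0 < r < 1 -> 0 < r' < 1 -> r != r' -> g r <> g r'.
  by move=> r01 r'01 /eqP ne /ig e; apply: ne; apply: e; exact: open01W.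
have m01 : 0 < (s + t) / 2 < 1 by lra.
have s01 : 0 < s < 1 by lra.
have t01 : 0 < t < 1 by lra.
pose p3 := upd (upd (upd p w1 (g s)) w2 (g ((s + t) / 2))) w3 (g t).
have sm : s != (s + t) / 2 by rewrite lt_eqF //; lra.
have mt : (s + t) / 2 != t by rewrite lt_eqF //; lra.
have ts : s != t by rewrite lt_eqF.
have D3 : arc_drawing E0 p3 a.
  apply: drawing_move; [|exact: isolated_sub i3|]; last first.
    apply: free_move; last by apply: gI; rewrite // eq_sym.
    apply: free_move; last by apply: gI; rewrite // eq_sym.
    exact: fr.
  apply: drawing_move; [|exact: isolated_sub i2|]; last first.
    apply: free_move; last by apply: gI; rewrite // eq_sym.
    exact: fr.
  by apply: drawing_move; [|exact: isolated_sub i1|exact: fr].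
have [uw1 vw1] := isolated_neq i1 uvE.
have [uw2 vw2] := isolated_neq i2 uvE.
have [uw3 vw3] := isolated_neq i3 uvE.
have pu : p3 u = g 0 by rewrite /p3 !upd_ne // gu.
have pv : p3 v = g 1 by rewrite /p3 !upd_ne // gv.
have p1 : p3 w1 = g s by rewrite /p3 !(upd_ne _ _ n13, upd_ne _ _ n12) upd_id.
have p2 : p3 w2 = g ((s + t) / 2) by rewrite /p3 (upd_ne _ _ n23) upd_id.
have p3' : p3 w3 = g t by rewrite /p3 upd_id.
have frg (r : R) : 0 < r < 1 -> r != s -> r != (s + t) / 2 -> r != t ->
    off_drawing E0 p3 a (g r).
  move=> r01 rs rm rt; do 3! (apply: free_move; last exact: gI).
  exact: fr.
have frk (r : R) : 0 < r < 1 -> off_drawing E0 p3 a (k r).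
  move=> /kP[kF kg]; do 3! (apply: free_move; last by apply: kg; exact: open01W).
  exact: contrapT.
have D4 : arc_drawing _ p3 _ := @drawing_add _ _ E0 p3 a w1 w3 k D3 _ frk.
rewrite p1 p3' in D4; have {}D4 := D4 ak.
have fr4 (r : R) : 0 < r < 1 -> r != s -> r != (s + t) / 2 -> r != t ->
    off_drawing ([set w1; w3]%SET |: E0) p3 (upd a [set w1; w3]%SET k) (g r).
  move=> r01 rs rm rt; apply: free_add; first exact: frg.
  by move=> r' /kP[_ /(_ r (open01W r01)) h] e; apply: h.
have t1' : t <= 1 by lra.
have sm' : s < (s + t) / 2 by lra.
have mt' : (s + t) / 2 < t by lra.
have s0' := ltW s0; have m0' : 0 <= (s + t) / 2 by lra.
have t0' : 0 <= t by lra.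
have m1' : (s + t) / 2 <= 1 by lra.
have s1' : s <= 1 by lra.
have off (i j r : R) : 0 <= i -> j <= 1 -> 0 < r < 1 -> ~~ (i < r < j) ->
    forall r', i < r' < j -> g r <> g r'.
  move=> i0 j1 r01 nr r' hr' /ig e; move/negP: nr; apply.
  by rewrite e //; clear -i0 j1 hr' r01; lra.
have ne (i j r x : R) : i < r < j -> (x <= i) || (j <= x) -> r != x.
  by move=> /andP[ir rj] /orP[xi|jx]; [rewrite gt_eqF ?(le_lt_trans xi)|
    rewrite lt_eqF ?(lt_le_trans rj)].
have [|D5 fr5] := drawing_add_piece D4 ag t0' t1 (lexx 1) p3' pv.
  by move=> r hr; apply: fr4; try (apply: (ne _ _ _ _ hr); apply/orP);
    (clear -hr s0 st t1; lra).
have [|D6 fr6] := drawing_add_piece D5 ag m0' mt' t1' p2 p3'.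
  move=> r hr; apply: fr5; last by apply: off => //; (clear -hr s0 st t1; lra).
  by apply: fr4; try (apply: (ne _ _ _ _ hr); apply/orP);
    (clear -hr s0 st t1; lra).
have [|D7 fr7] := drawing_add_piece D6 ag s0' sm' m1' p1 p2.
  move=> r hr; apply: fr6; last by apply: off => //; (clear -hr s0 st t1; lra).
  apply: fr5; last by apply: off => //; (clear -hr s0 st t1; lra).
  by apply: fr4; try (apply: (ne _ _ _ _ hr); apply/orP);
    (clear -hr s0 st t1; lra).
have [|D8 _] := drawing_add_piece D7 ag (lexx 0) s0 s1' pu p1.
  move=> r hr; apply: fr7; last by apply: off => //; (clear -hr s0 st t1; lra).
  apply: fr6; last by apply: off => //; (clear -hr s0 st t1; lra).
  apply: fr5; last by apply: off => //; (clear -hr s0 st t1; lra).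
  by apply: fr4; try (apply: (ne _ _ _ _ hr); apply/orP);
    (clear -hr s0 st t1; lra).
by eexists; eexists; exact: D8.
Qed.

Lemma drawable_smooth E u v w : drawable R E ->
  [set u; w]%SET \in E -> [set w; v]%SET \in E -> u != v ->
  (forall e, e \in E -> w \in e -> e = [set u; w]%SET \/ e = [set w; v]%SET) ->
  drawable R ([set u; v] |: (E :\ [set u; w] :\ [set w; v]))%SET.
Proof.
move=> [p [a D]] uwE wvE uv wE; have [ip arcs av aa] := D.
pose E1 := (E :\ [set u; w])%SET.
pose E0 := (E1 :\ [set w; v])%SET.
have sub1 : E1 \subset E by exact: subD1set.
have sub0 : E0 \subset E by exact: fintype.subset_trans (subD1set _ _) sub1.
have iw : isolated_in E0 w.
  move=> e; rewrite !inE => /and3P[e1 e2 /wE h]; apply/negP => /h[] e'.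
    by rewrite e' eqxx in e2.
  by rewrite e' eqxx in e1.
have uw : u != w := drawing_neq D uwE.
have wv : w != v := drawing_neq D wvE.
have euw : [set u; w]%SET != [set w; v]%SET.
  by apply/eqP => /set2P_or[[/eqP]|[/eqP]]; rewrite ?(negbTE uw) ?(negbTE uv).
have [g ag ga] := drawing_edge D uwE; have frg := edge_free D uwE ga.
have [h ah ha] := drawing_edge D wvE; have frh := edge_free D wvE ha.
have [_ ig g0 g1] := ag; have [_ ih h0 h1] := ah.
have h01 : 0 < (1 / 2 : R) < 1 by lra.
(* The old position of [w] is interior to the merged edge, so [w] must be placed elsewhere. An inner
   point of a chord next to the arc is off the whole drawing. *)
have [|||_ [_ [k [_ _ _ _ kP]]]] := near_chord ag (free_closed (drawing_sub sub1 D)).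
- by apply; exact: frg.
- by case=> /(_ u).
- by case=> /(_ w).
have [kF kg] := kP _ h01; have {kF}kF := contrapT kF.
have gh (s t : R) : 0 <= s <= 1 -> 0 <= t <= 1 -> g s = h t -> s = 1 /\ t = 0.
  move=> s01 t01 e.
  have [s1|s1] := eqVneq s 1.
    by split => //; apply: ih; rewrite ?lexx ?ler01 // -e s1 g1 h0.
  exfalso; have [s0|s0] := eqVneq s 0.
    rewrite s0 g0 in e; have [t1|t1] := eqVneq t 1.
      by move: e; rewrite t1 h1 => /ip/eqP; rewrite (negbTE uv).
    have [t0|t0] := eqVneq t 0.
      by move: e; rewrite t0 h0 => /ip/eqP; rewrite (negbTE uw).
    have to : 0 < t < 1 by rewrite !lt_neqAle eq_sym t0 t1.
    by have [hp _] := frh _ to; exact: (hp u).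
  have so : 0 < s < 1 by rewrite !lt_neqAle eq_sym s0 s1.
  have [gp gf] := frg _ so.
  have [t1|t1] := eqVneq t 1; first by apply: (gp v); rewrite e t1 h1.
  have [t0|t0] := eqVneq t 0; first by apply: (gp w); rewrite e t0 h0.
  have [|r r01 er] := ha t; first by rewrite !lt_neqAle eq_sym t0 t1.
  apply: (gf [set w; v]%SET _ r r01); last by rewrite e er.
  by rewrite !inE eq_sym euw.
have [c ac cP] := cat_arc ag ah gh.
have zfree : off_drawing E0 p a (k (1 / 2)) by apply: free_sub kF; exact: subD1set.
have D1 := drawing_move (drawing_sub sub0 D) iw zfree.
have D2 : arc_drawing ([set u; v]%SET |: E0) (upd p w (k (1 / 2)))
    (upd a [set u; v]%SET c).
  apply: (@drawing_add _ _ E0 _ a u v c D1).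
    by rewrite !upd_ne // eq_sym.
  have zw : k (1 / 2) <> p w by case: kF => /(_ w).
  move=> r /cP[[s s01 ->]|->|[s s01 ->]].
  - apply: free_move; last by move/esym; apply: kg; exact: open01W.
    by apply: free_sub (frg _ s01); exact: subD1set.
  - split.
      move=> x; rewrite /upd; case: eqVneq => [_ /esym //|xw /ip/eqP].
      by rewrite eq_sym (negbTE xw).
    by move=> f fE s s01 /esym; apply: av => //; exact: (fintype.subsetP sub0).
  - apply: free_move.
      by apply: free_sub (frh _ s01); apply: finset.setSD.
    move=> e; have [r' r'01 er] := ha _ s01.
    have [_ kf] := kF; apply: (kf [set w; v]%SET _ r' r'01); last by rewrite -er.
    by rewrite !inE eq_sym euw.
by eexists; eexists; exact: D2.
Qed.

End Ops.

(** * Making a drawing radial near a vertex *)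

Section Star.
Local Open Scope classical_set_scope.
Local Open Scope ring_scope.
Variables (R : realType) (V : finType).
Notation P := (R * R)%type.
Implicit Types (E : {set {set V}}) (p : V -> P) (a : {set V} -> R -> P).

(** Used for slopes. Keeping the interval inside [0, 1] ensures that (x, x t) has sup norm x for
    every slope t in it and x > 0. *)
Lemma interval_avoiding (s : seq R) :
  exists a b : R, [/\ 0 <= a, a < b, b <= 1 & forall x, a <= x <= b -> x \notin s].
Proof.
elim: s => [|y s [a [b [a0 ab b1 h]]]].
  by exists 0, 1; split.
have [yl|yr] := ltP y ((a + b) / 2).
  exists ((a + b) / 2), b; split; [lra|lra|lra|] => x hx.
  rewrite inE negb_or h; last lra.
  by rewrite andbT gt_eqF //; lra.
exists a, ((3 * a + b) / 4); split; [lra|lra|lra|] => x hx.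
rewrite inE negb_or h; last lra.
by rewrite andbT lt_eqF //; lra.
Qed.

(** The last exit is the first hit of the closed disc by the reversed arc. The distance there is
    exactly [r], since by continuity a smaller one would keep slightly later points inside. *)
Lemma last_exit (g : R -> P) (y : P) (r : R) : simple_arc g (g 0) y -> 0 < r ->
  r < `|y - g 0| ->
  exists s, [/\ 0 < s < 1, `|g s - g 0| = r &
    forall t, s < t <= 1 -> r < `|g t - g 0|].
Proof.
move=> ag r0 ry; have [cg ig _ g1] := ag; have [cr _ r0' _] := rev_arc ag.
have cn : continuous (fun t => `|g t - g 0|).
  move=> t; apply: cvg_norm; apply: cvgB; last exact: cvg_cst.
  exact: cg.
pose B : set P := [set z | `|z - g 0| <= r].
have cB : closed B.
  have -> : B = (fun z : P => `|z - g 0|) @^-1` `]-oo, r].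
    by apply/seteqP; split => z /=; rewrite in_itv.
  apply: preimage_closed; last exact: lray_closed.
  move=> z _; apply: cvg_norm; apply: cvgB; last exact: cvg_cst.
  exact: cvg_id.
have [|||t [t01 /= Bt tmin]] := @first_hit _ (fun t => g (1 - t)) B 1 cr cB.
- by rewrite /B /= subr0 g1 leNgt ry.
- by rewrite ler01 lexx.
- by rewrite /B /= subrr subrr normr0 ltW.
have t1 : t != 1.
  apply/eqP => t1.
  have : nbhs (0 : R) ((fun t => `|g t - g 0|) @^-1` [set x | x < r]).
    apply: (cn 0); rewrite subrr normr0.
    by apply: open_nbhs_nbhs; split => //; exact: open_lt.
  move/nbhs_ballP => [h /= h0 hb].
  pose m := Num.min (h / 2) (1 / 2).
  have m0 : 0 < m by rewrite lt_min; lra.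
  have mh : m < h by rewrite gt_min; lra.
  have m4 : m <= 1 / 2 by rewrite ge_min lexx orbT.
  have : `|g m - g 0| < r.
    by apply: hb; rewrite -ball_normE /= sub0r normrN gtr0_norm.
  apply/negP; rewrite -leNgt.
  have tm : 0 <= 1 - m < t by rewrite t1; lra.
  move: (tmin _ tm); rewrite /B /= subKr => /negP.
  by rewrite -ltNge => /ltW.
have t1' : t < 1 by rewrite lt_neqAle t1; case/andP: t01.
have out s : 1 - t < s <= 1 -> r < `|g s - g 0|.
  move=> hs; have tm : 0 <= 1 - s < t by lra.
  move: (tmin _ tm); rewrite /B /= subKr => /negP.
  by rewrite -ltNge.
exists (1 - t); split; [lra| |exact: out].
apply/eqP; rewrite eq_le Bt leNgt; apply/negP => lt.
have : nbhs (1 - t) ((fun t => `|g t - g 0|) @^-1` [set x | x < r]).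
  by apply: (cn (1 - t)); apply: open_nbhs_nbhs; split => //; exact: open_lt.
move/nbhs_ballP => [h /= h0 hb].
pose m := Num.min (h / 2) t.
have m0 : 0 < m by rewrite lt_min; apply/andP; split; lra.
have mh : m < h by rewrite gt_min; apply/orP; left; lra.
have mt : m <= t by rewrite ge_min lexx orbT.
have l1 : `|g (1 - t + m) - g 0| < r.
  by apply: hb; rewrite -ball_normE /= opprD addNKr normrN gtr0_norm.
have : r < `|g (1 - t + m) - g 0| by apply: out; lra.
by rewrite ltNge (ltW l1).
Qed.

Lemma seg_arc (x y : P) : x != y -> simple_arc (fun t : R => x + t *: (y - x)) x y.
Proof.
move=> xy; split.
- move=> t; apply: cvgD; first exact: cvg_cst.
  by apply: cvgZr_tmp; exact: cvg_id.
- move=> s t _ _ /addrI /eqP; rewrite -subr_eq0 -scalerBl scaler_eq0 !subr_eq0.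
  by rewrite [y == x]eq_sym (negbTE xy) orbF => /eqP.
- by rewrite scale0r addr0.
- by rewrite scale1r addrC subrK.
Qed.

(* Every edge at [v] is replaced, inside a small disc around [p v], by a radius
   running to its last exit from the disc; between two radii there is room. *)
Lemma free_sector E p a v : arc_drawing E p a ->
  exists a' (h t1 t2 : R), [/\ 0 < h, t1 < t2, arc_drawing E p a' &
    forall x t, 0 < x <= h -> t1 <= t <= t2 ->
      off_drawing E p a' ((p v).1 + x, (p v).2 + x * t)].
Proof.
move=> D; have [ip arcs av aa] := D.
pose E' := [set e in E | v \notin e]%SET.
have sub : E' \subset E by apply/fintype.subsetP => e; rewrite inE => /andP[].
pose F := p @` [set x | x != v] `|` \bigcup_(f in [set` E']) (a f @` `[0, 1]).
have cF : closed F by apply: partial_drawing_closed; exact: drawing_sub sub D.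
have nF : ~ F (p v).
  case=> [[x /= xv /ip/eqP]|[f /= fE' [s]]]; first by rewrite (negbTE xv).
  move: fE'; rewrite inE => /andP[fE vf]; rewrite /= in_itv /= => s01 e.
  have [x [y [fxy [_ _ a0 a1]]]] := arcs f fE.
  have [s0|s0] := eqVneq s 0.
    by move: e vf; rewrite s0 a0 fxy => /ip ->; rewrite !inE eqxx.
  have [s1|s1] := eqVneq s 1.
    by move: e vf; rewrite s1 a1 fxy => /ip ->; rewrite !inE eqxx orbT.
  by apply: (av f fE s _ v) => //; rewrite !lt_neqAle eq_sym s0 s1.
have [e0 e00 eF] : exists2 e : R, 0 < e & ball (p v) e `<=` ~` F.
  by have := closed_openC cF; rewrite openE => /(_ _ nF) /nbhs_ballP[e]; exists e.
have near z : `|z - p v| < e0 -> ~ F z.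
  by move=> h; apply: eF; rewrite -ball_normE /= distrC.
pose r := e0 / 2.
have r0 : 0 < r by rewrite /r; lra.
have re : r < e0 by rewrite /r; lra.
(* [kc] pairs the new arc with the exit point. Every inner point of the new arc lies either on the
   radius to the exit point or outside the disc on the old arc. *)
pose Q e (kc : (R -> P) * P) := exists u, [/\ e = [set v; u]%SET,
  simple_arc kc.1 (p v) (p u), `|kc.2 - p v| = r,
  exists2 s, 0 < s < 1 & kc.2 = a e s &
  forall t : R, 0 < t < 1 ->
    (exists2 l, 0 < l <= 1 & kc.1 t = p v + l *: (kc.2 - p v)) \/
    (r < `|kc.1 t - p v| /\ exists2 s, 0 < s < 1 & kc.1 t = a e s)].
have exQ e : exists kc, e \in E -> v \in e -> Q e kc.
  have [eE|] := boolP (e \in E); last by exists (fun=> p v, p v).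
  have [ve|] := boolP (v \in e); last by exists (fun=> p v, p v).
  have [u euv] : exists u, e = [set v; u]%SET.
    have [x [y [exy _]]] := arcs e eE; move: ve; rewrite exy !inE.
    by case/orP => /eqP ->; [exists y|exists x; rewrite finset.setUC].
  rewrite euv in eE ve *.
  have [g ag ga] := drawing_edge D eE; have [_ ig g0 g1] := ag.
  have vu := drawing_neq D eE.
  have [||s [s01 gs out]] := @last_exit g (p u) r _ r0.
  - by rewrite g0.
  - rewrite g0; apply: (lt_le_trans re); rewrite leNgt; apply/negP => /near; apply.
    by left; exists u => //=; rewrite eq_sym.
  rewrite g0 in gs out.
  have cv : p v != g s.
    by apply/eqP => ec; move: gs; rewrite -ec subrr normr0 => r00;
      move: r0; rewrite -r00 ltxx.
  have as1 : simple_arc (fun t => g (s + (1 - s) * t)) (g s) (p u).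
    by rewrite -g1; apply: (sub_arc ag); [lra|lra|rewrite lt_eqF //; lra].
  have [|k ak kP] := cat_arc (seg_arc cv) as1.
    move=> l t l01 t01 el.
    have nl : `|p v + l *: (g s - p v) - p v| = l * r.
      by rewrite addrC addKr normrZ gs ger0_norm //; case/andP: l01.
    have [t0|t0] := eqVneq t 0.
      split => //; move: nl; rewrite el t0 mulr0 addr0 gs => /eqP.
      rewrite -{1}[r]mul1r -subr_eq0 -mulrBl mulf_eq0 (gt_eqF r0) orbF subr_eq0.
      by move/eqP.
    have : r < l * r.
      rewrite -nl el; apply: out.
      have t0' : 0 < t by rewrite lt_neqAle eq_sym t0; case/andP: t01.
      nra.
    by rewrite ltNge ger_pMl //; case/andP: l01 => _ ->.
  exists (k, g s) => _ _; exists u; split => //; first exact: ga.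
  move=> t t01 /=; have [[l l01 ->]|->|[l l01 ->]] := kP t t01.
  - by left; exists l => //; lra.
  - by left; exists 1; [lra|rewrite scale1r addrC subrK].
  - by right; split; [apply: out; nra|apply: ga; nra].
have [kc kcQ] := choice exQ.
pose a' (e : {set V}) := if v \in e then (kc e).1 else a e.
have ballF (l : R) (c : P) : 0 < l <= 1 -> `|c - p v| = r ->
    [/\ p v + l *: (c - p v) <> p v, ~ F (p v + l *: (c - p v)) &
      `|p v + l *: (c - p v) - p v| <= r].
  move=> l01 cr.
  have nl : `|p v + l *: (c - p v) - p v| = l * r.
    by rewrite addrC addKr normrZ cr ger0_norm //; lra.
  split.
  - move=> e; move: nl; rewrite e subrr normr0 => /esym/eqP.
    rewrite mulf_eq0 (gt_eqF r0) orbF => /eqP l0.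
    by move: l01; rewrite l0 ltxx.
  - by apply: near; rewrite nl; nra.
  - by rewrite nl; nra.
have notF (f : {set V}) (s : R) : f \in E -> v \notin f -> 0 < s < 1 -> F (a f s).
  move=> fE vf s01; right; exists f; first by rewrite /= inE fE vf.
  by exists s => //=; rewrite in_itv /= open01W.
have notFx (x : V) : x != v -> F (p x) by move=> xv; left; exists x.
have D' : arc_drawing E p a'.
  split => //.
  - move=> e eE; rewrite /a'; case: ifP => [ve|_]; last exact: arcs.
    by have [u [e_ ak _ _ _]] := kcQ e eE ve; exists v, u.
  - move=> e eE t t01 x; rewrite /a'; case: ifP => [ve|_]; last exact: av.
    have [u [e_ ak cr _ kP]] := kcQ e eE ve.
    have [[l l01 ->]|[_ [s s01 ->]]] := kP t t01; last exact: av.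
    have [b1 b2 _] := ballF l _ l01 cr.
    have [->|xv ex] := eqVneq x v; first exact: b1.
    by apply: b2; rewrite ex; exact: notFx.
  - have mixed (e f : {set V}) (s t : R) :
        e \in E -> f \in E -> e != f -> v \in e -> v \notin f ->
        0 < s < 1 -> 0 < t < 1 -> (kc e).1 s <> a f t.
      move=> eE fE ef ve vf s01 t01.
      have [u [e_ ak cr _ kP]] := kcQ e eE ve.
      have [[l l01 ->]|[_ [s' s'01 ->]]] := kP s s01; last exact: aa.
      have [_ b2 _] := ballF l _ l01 cr.
      by move=> ex; apply: b2; rewrite ex; exact: notF.
    move=> e f eE fE ef s t s01 t01; rewrite /a'.
    case: ifP => [ve|/negbT ve]; case: ifP => [vf|/negbT vf].
    + have [u [e_ ak cr [s1 s101 es1] kP]] := kcQ e eE ve.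
      have [u' [f_ ak' cr' [t1 t101 et1] kP']] := kcQ f fE vf.
      have [[l l01 ->]|[ out1 [s' s'01 es']]] := kP s s01;
        have [[l' l'01 el']|[ out2 [t' t'01 et']]] := kP' t t01.
      (* A common point of two radii: equal distances from the centre make the scalars equal, hence
         also the exit points, which lie on different old edges. *)
      * rewrite el' => /addrI ell.
        have : `|l *: ((kc e).2 - p v)| = `|l' *: ((kc f).2 - p v)| by rewrite ell.
        rewrite !normrZ cr cr' !ger0_norm; [|lra|lra] => /eqP.
        rewrite -subr_eq0 -mulrBl mulf_eq0 (gt_eqF r0) orbF subr_eq0 => /eqP ll.
        move: ell; rewrite -ll => /eqP; rewrite -subr_eq0 -scalerBr scaler_eq0.
        have l0 : l != 0 by rewrite gt_eqF //; case/andP: l01.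
        rewrite (negbTE l0) /= opprB addrA subrK subr_eq0 es1 et1 => /eqP.
        exact: aa.
      * have [_ _ b3] := ballF l _ l01 cr.
        by move=> ex; move: out2; rewrite -ex ltNge b3.
      * have [_ _ b3] := ballF l' _ l'01 cr'.
        by move=> ex; move: out1; rewrite ex el' ltNge b3.
      * by rewrite es' et'; exact: aa.
    + exact: mixed.
    + by apply/nesym; apply: mixed => //; rewrite eq_sym.
    + exact: aa.
(* A vertical radius gets slope 0 by division by zero. This does no harm: the points of the sector
   have positive first offset and never lie on such a radius. *)
pose slope (e : {set V}) := ((kc e).2 - p v).2 / ((kc e).2 - p v).1.
have [t1 [t2 [t10 t12 t21 tP]]] := interval_avoiding [seq slope e | e <- enum E].
exists a', (r / 2), t1, t2; split => //; first lra.
move=> x t hx ht; set q := (_, _).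
have qn : `|q - p v| < r.
  rewrite (_ : q - p v = (x, x * t)); last first.
    by rewrite /q; case: (p v) => y z; congr (_, _) => /=; rewrite addrC addKr.
  rewrite prod_normE /= gt_max !ger0_norm; [|nra|lra].
  by apply/andP; split; nra.
have qF : ~ F q by apply: near; exact: lt_trans re.
have qv : q <> p v.
  rewrite /q; case: (p v) => y z [/eqP]; rewrite -subr_eq0 addrC addKr => /eqP x0.
  by move: hx; rewrite x0 ltxx.
split.
  move=> z; have [->|zv ez] := eqVneq z v; [exact: qv|apply: qF].
  by rewrite ez; exact: notFx.
move=> f fE s s01; rewrite /a'; case: ifP => [vf|/negbT vf]; last first.
  by move=> eq; apply: qF; rewrite eq; exact: notF.
have [u [f_ ak cr _ kP]] := kcQ f fE vf.
have [[l l01 ->]|[ out _]] := kP s s01; last first.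
  by move=> eq; move: out; rewrite -eq ltNge (ltW qn).
move=> eq; have /negP := tP t ht; apply.
have {}eq : l *: ((kc f).2 - p v) = (x, x * t).
  apply: (addrI (p v)); rewrite -eq /q; case: (p v) => y z //.
apply/mapP; exists f; first by rewrite mem_enum.
rewrite /slope; move: eq; case: (_ - _) => c1 c2 /= [e1 e2].
have l0 : l != 0 by rewrite gt_eqF //; case/andP: l01.
have x0 : x != 0 by rewrite gt_eqF //; case/andP: hx.
have c10 : c1 != 0 by apply/eqP => c; move: x0; rewrite -e1 c /GRing.scale /= mulr0 eqxx.
apply: (mulfI x0); rewrite -e2 -e1 /GRing.scale /=; field.
exact: c10.
Qed.

End Star.

(** * Pendant edges and triangles, and renaming of vertices *)

Section Pendant.
Local Open Scope classical_set_scope.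
Local Open Scope ring_scope.
Variables (R : realType) (V : finType).
Notation P := (R * R)%type.
Implicit Types (E : {set {set V}}) (p : V -> P) (a : {set V} -> R -> P).

Lemma false_lt : (0 : R) < 0 -> False.
Proof. by rewrite ltxx. Qed.

(** The new vertices go to the two bounding rays of a free sector at [v], and the three edges are
    straight segments inside the sector. *)
Lemma drawable_pendant_triangle E v w1 w2 : drawable R E ->
  isolated_in E w1 -> isolated_in E w2 -> v != w1 -> v != w2 -> w1 != w2 ->
  drawable R ([set v; w1] |: ([set v; w2] |: ([set w1; w2] |: E)))%SET.
Proof.
move=> [p [a0 D0]] i1 i2 vw1 vw2 w12.
have [a [h [t1 [t2 [h0 t12 D fr]]]]] := free_sector v D0.
pose sec (x t : R) : P := ((p v).1 + x, (p v).2 + x * t).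
have secI x t x' t' : 0 < x -> sec x t = sec x' t' -> x = x' /\ t = t'.
  move=> x0 [/addrI <- /addrI /mulfI e]; split => //; apply: e.
  by rewrite gt_eqF.
have fr' x t : 0 < x <= h -> t1 <= t <= t2 -> off_drawing E p a (sec x t) by exact: fr.
have hh : 0 < h <= h by rewrite h0 lexx.
have t11 : t1 <= t1 <= t2 by lra.
have t22 : t1 <= t2 <= t2 by lra.
have q12 : sec h t1 <> sec h t2.
  by case/(secI _ _ _ _ h0) => _ e; move: t12; rewrite e ltxx.
have D1 := drawing_move D i1 (fr' _ _ hh t11).
have D2 : arc_drawing E _ a :=
  drawing_move D1 i2
    (@free_move _ _ _ _ _ _ _ _ (fr' _ _ hh t22) (nesym q12)).
set p2 := upd _ w2 _ in D2.
have pv : p2 v = p v by rewrite /p2 !upd_ne.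
have pw1 : p2 w1 = sec h t1 by rewrite /p2 upd_ne // upd_id.
have pw2 : p2 w2 = sec h t2 by rewrite /p2 upd_id.
have fr2 x t : 0 < x <= h -> t1 <= t <= t2 -> sec x t <> sec h t1 ->
    sec x t <> sec h t2 -> off_drawing E p2 a (sec x t).
  by move=> hx ht n1 n2; do 2! apply: free_move => //; exact: fr'.
have pvq t : p v != sec h t.
  apply/eqP; rewrite [p v]surjective_pairing /sec => -[/eqP].
  by rewrite eq_sym -subr_eq0 addrC addKr (gt_eqF h0).
have e12 (s : R) : sec h t1 + s *: (sec h t2 - sec h t1) = sec h (t1 + s * (t2 - t1)).
  by rewrite /sec; congr (_, _); rewrite /= /GRing.scale /=; ring.
have ev (t s : R) : p v + s *: (sec h t - p v) = sec (s * h) t.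
  by rewrite /sec; case: (p v) => y z; congr (_, _); rewrite /= /GRing.scale /=; ring.
have A12 := seg_arc (introN eqP q12).
have A1 := seg_arc (pvq t1); have A2 := seg_arc (pvq t2).
rewrite -pw1 -pw2 in A12; rewrite -pv -pw1 in A1; rewrite -pv -pw2 in A2.
have D3 : arc_drawing _ p2 _ := drawing_add D2 A12 _.
have {}D3 := D3 _.
eexists; eexists; apply: (drawing_add _ A1).
- apply: (drawing_add _ A2).
  + apply: D3 => s s01; rewrite pw1 pw2 e12; apply: fr2 => //; first nra.
    * by move/(secI _ _ _ _ h0) => [_ e]; apply: false_lt; nra.
    * by move/(secI _ _ _ _ h0) => [_ e]; apply: false_lt; nra.
  + move=> s s01; apply: free_add.
      rewrite pv pw2 ev; apply: fr2 => //; first nra.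
      * by move/(secI _ _ _ _) => e; have [|e1 e2] := e; [nra|apply: false_lt; nra].
      * by move/(secI _ _ _ _) => e; have [|e1 e2] := e; [nra|apply: false_lt; nra].
    move=> r r01; rewrite pv pw1 pw2 ev e12 => /secI e.
    by have [|e1 e2] := e; [nra|apply: false_lt; nra].
- move=> s s01; apply: free_add.
    apply: free_add.
      rewrite pv pw1 ev; apply: fr2 => //; first nra.
      * by move/(secI _ _ _ _) => e; have [|e1 e2] := e; [nra|apply: false_lt; nra].
      * by move/(secI _ _ _ _) => e; have [|e1 e2] := e; [nra|apply: false_lt; nra].
    move=> r r01; rewrite pv pw1 pw2 ev e12 => /secI e.
    by have [|e1 e2] := e; [nra|apply: false_lt; nra].
  move=> r r01; rewrite pv pw1 pw2 !ev => /secI e.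
    by have [|e1 e2] := e; [nra|apply: false_lt; nra].
Qed.

Lemma drawable_pendant E v w : drawable R E -> isolated_in E w -> v != w ->
  drawable R ([set v; w] |: E)%SET.
Proof.
move=> [p [a0 D0]] iw vw.
have [a [h [t1 [t2 [h0 t12 D fr]]]]] := free_sector v D0.
have t11 : t1 <= t1 <= t2 by lra.
have hh : 0 < h <= h by rewrite h0 lexx.
have D1 := drawing_move D iw (fr _ _ hh t11).
set q := (_, _) in D1; set p1 := upd _ _ _ in D1.
have pv : p1 v = p v by rewrite /p1 !upd_ne.
have pw : p1 w = q by rewrite /p1 upd_id.
have pvq : p v != q.
  apply/eqP; rewrite [p v]surjective_pairing /q => -[/eqP].
  by rewrite eq_sym -subr_eq0 addrC addKr (gt_eqF h0).
have ev (s : R) : p v + s *: (q - p v) = ((p v).1 + s * h, (p v).2 + (s * h) * t1).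
  by rewrite /q; case: (p v) => y z; congr (_, _); rewrite /= /GRing.scale /=; ring.
have A := seg_arc pvq; rewrite -pv -pw in A.
eexists; eexists; apply: (drawing_add D1 A).
move=> s s01; rewrite pv pw ev; apply: free_move; first by apply: fr => //; nra.
rewrite /q => -[/addrI e _]; have : (1 - s) * h = 0 by lra.
move/eqP; rewrite mulf_eq0 (gt_eqF h0) orbF subr_eq0 => /eqP s1.
by move: s01; rewrite -s1 ltxx andbF.
Qed.

(** Needed for exchanging two vertices; for an involution the map induced on edges is its own
    inverse. *)
Lemma drawable_rename E (s : V -> V) : involutive s -> drawable R E ->
  drawable R [set s @: e | e : {set V} in E]%SET.
Proof.
move=> sK [p [a [ip arcs av aa]]].
have sKe (e : {set V}) : (s @: (s @: e) = e)%SET.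
  by rewrite -finset.imset_comp -[RHS]finset.imset_id;
    apply: finset.eq_imset => x /=; rewrite sK.
exists (p \o s), (fun e : {set V} => a (s @: e)%SET); split.
- by move=> x y /= /ip /(can_inj sK).
- move=> _ /imsetP[e eE ->]; rewrite sKe /=.
  have [u [v [-> ar]]] := arcs e eE; exists (s u), (s v); rewrite !sK.
  by split => //; rewrite imsetU1 finset.imset_set1.
- by move=> _ /imsetP[e eE ->] t t01 x; rewrite sKe; exact: av.
- move=> _ _ /imsetP[e eE ->] /imsetP[f fE ->] ef t t' t01 t'01.
  by rewrite !sKe; apply: aa => //; apply: contra ef => /eqP ->.
Qed.

End Pendant.

(* [all_classical] shadows the lemmas on finite sets used from here on. *)
From mathcomp Require Import fintype finset.

(** * Addable edges: contracting leaves and long bare paths *)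

Section Reduction.
Variables (R : realType) (V : finType).
Implicit Types (E F X : {set {set V}}) (U : {set V}).
Local Notation pl := (drawable R).

Definition supported E U := forall e, e \in E -> #|e| = 2 /\ e \subset U.

Definition degree2 E u w v := [/\ [set u; w] \in E, [set w; v] \in E, u != v &
  forall e, e \in E -> w \in e -> e = [set u; w] \/ e = [set w; v]].

Definition leaf E v w := [set v; w] \in E /\
  forall e, e \in E -> w \in e -> e = [set v; w].

(* [f] sorts the vertices of [E] into classes, one for each vertex of the smaller
   graph [E0]; vertices of the same class can be joined by an edge.  The last
   clause, about doubling an edge inside a class, is what the induction needs
   when two vertices of a class become adjacent. *)
Definition label_reduction E U E0 U0 (f : V -> V) :=
  [/\ [/\ U0 \subset U, {in U, forall x, f x \in U0} & {in U0, f =1 id}],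
      [/\ supported E0 U0, pl E0 & (#|E0| + #|U| = #|E| + #|U0|)%N],
      {in U &, forall x y, x != y -> f x = f y -> pl ([set x; y] |: E)},
      {in U &, forall x y, f x != f y -> [set f x; f y] \notin E0 ->
         pl ([set f x; f y] |: E0) -> pl ([set x; y] |: E)} &
      (forall x y, [set x; y] \in E ->
         f x = f y \/ [set f x; f y] \in E0) /\
      (forall x y s, [set x; y] \in E -> f x = f y -> s \notin U ->
         pl ([set s; x] |: ([set s; y] |: E)))].

Lemma supported_pair E U x y : supported E U -> [set x; y] \in E ->
  [/\ x != y, x \in U & y \in U].
Proof.
move=> sE /sE[]; rewrite cards2 subUset !sub1set; case: eqVneq => // _ _.
by case/andP.
Qed.

Lemma supported_isolated E U s : supported E U -> s \notin U -> isolated_in E s.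
Proof. by move=> sE sU e /sE[_ /subsetP eU]; apply: contra sU => /eU. Qed.

Lemma supported_ends E U e : supported E U -> e \in E ->
  exists x y, [/\ e = [set x; y], x != y, x \in U & y \in U].
Proof.
move=> sE eE; have [/eqP/cards2P[x [y [xy e_]]] _] := sE e eE; exists x, y.
by rewrite e_ in eE *; have [] := supported_pair sE eE.
Qed.

Lemma isolated_add E x y w : isolated_in E w -> x != w -> y != w ->
  isolated_in ([set x; y] |: E) w.
Proof.
move=> iw xw yw e; rewrite !inE => /orP[/eqP ->|/iw //].
by rewrite !inE negb_or ![w == _]eq_sym xw.
Qed.

Lemma isolatedU E X w : isolated_in E w -> isolated_in X w -> isolated_in (X :|: E) w.
Proof. by move=> iE iX e; rewrite inE => /orP[/iX|/iE]. Qed.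

Lemma isolated_subset E E' w : E' \subset E -> isolated_in E w -> isolated_in E' w.
Proof. by move=> /subsetP sub iw e /sub; exact: iw. Qed.

Lemma subdivide_edge F u v w : pl ([set u; v] |: F) -> [set u; v] \notin F ->
  isolated_in ([set u; v] |: F) w -> pl ([set u; w] |: ([set w; v] |: F)).
Proof.
move=> h uvF iw; have := drawable_subdivide h (setU11 _ _) iw.
by rewrite setU1K.
Qed.

Lemma label_reduction_id E U : supported E U -> pl E -> label_reduction E U E U id.
Proof.
move=> sE pE; split.
- by split => //; exact: subxx.
- by [].
- by move=> x y _ _ /eqP.
- by [].
- split; first by right.
  by move=> x y s /(supported_pair sE)[/eqP].
Qed.

(** The leaf joins the class of its neighbour. To join [w] to [y], draw the edge from [v] to [y] in
    the graph without the leaf and subdivide it by [w]. Since [w] lies outside [U :\ w], it can also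
    be the vertex [s] of the doubling clause of the smaller graph. *)
Lemma leaf_step E U E0 U0 f v w : supported E U -> pl E -> leaf E v w ->
  label_reduction (E :\ [set v; w]) (U :\ w) E0 U0 f ->
  label_reduction E U E0 U0 (upd f w (f v)).
Proof.
move=> sE pE [vwE only] [[U0U fU fid] [sE0 pE0 card] h1 h2 [h3 h4]].
set F := E :\ [set v; w] in h1 h2 h3 h4 card.
have [vw vU wU] := supported_pair sE vwE.
have EF : E = [set v; w] |: F by rewrite setD1K.
have iw : isolated_in F w.
  by move=> e; rewrite !inE => /andP[ne eE]; apply: contra ne => /only ->.
have vU1 : v \in U :\ w by rewrite !inE vw.
have inU1 x : x \in U -> x != w -> x \in U :\ w by rewrite !inE => -> ->.
have fv : upd f w (f v) v = f v by rewrite upd_ne.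
have fw : upd f w (f v) w = f v by rewrite upd_id.
have fx x : x != w -> upd f w (f v) x = f x by move=> xw; rewrite upd_ne.
have addw x y : x != w -> y != w -> pl ([set x; y] |: F) -> pl ([set x; y] |: E).
  move=> xw yw h; rewrite EF setUCA; apply: drawable_pendant => //.
  exact: isolated_add.
have attach y : y != w -> [set v; y] \notin F -> pl ([set v; y] |: F) ->
    pl ([set w; y] |: E).
  move=> yw nF h; rewrite EF setUCA; apply: subdivide_edge => //.
  exact: isolated_add.
have w0 : w \notin U0 by apply/negP => /(subsetP U0U); rewrite !inE eqxx.
split.
- split.
  + by apply: subset_trans U0U _; exact: subD1set.
  + move=> x xU; have [->|xw] := eqVneq x w; first by rewrite fw fU.
    by rewrite fx // fU // inU1.
  + by move=> x xU0; rewrite fx ?fid //; apply: contraNneq w0 => <-.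
- split => //; move: card; rewrite (cardsD1 w U) wU (cardsD1 [set v; w] E) vwE.
  by rewrite -/F !add1n addnS => ->.
- have main y : y \in U -> w != y -> f v = f y -> pl ([set w; y] |: E).
    move=> yU; rewrite eq_sym => yw fe.
    have [->|yv] := eqVneq y v.
      by apply: drawable_sub pE; rewrite subUset subxx andbT sub1set setUC.
    (* If [v] and [y] are already adjacent, there is no new edge to subdivide; doubling their edge
       with [w] as the middle vertex gives the same result. *)
    have [vyF|vyF] := boolP ([set v; y] \in F).
      have := h4 _ _ w vyF fe; rewrite !inE eqxx => /(_ isT).
      by rewrite EF [[set v; w]]setUC [X in _ -> pl X]setUCA.
    apply: attach => //; apply: h1 => //; last by rewrite eq_sym.
    exact: inU1.
  move=> x y xU yU xy; have [xw|xw] := eqVneq x w.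
    by rewrite xw fw in xy *; rewrite fx 1?eq_sym // => fe; exact: main.
  have [yw|yw] := eqVneq y w.
    move: xy; rewrite yw fw fx // [[set x; w]]setUC eq_sym => wx fe.
    exact: main (esym fe).
  by rewrite !fx // => fe; apply: addw => //; apply: h1 => //; apply: inU1.
- have main y : y \in U -> y != w -> f v != f y -> [set f v; f y] \notin E0 ->
      pl ([set f v; f y] |: E0) -> pl ([set w; y] |: E).
    move=> yU yw fe nE h; apply: attach => //; last by apply: h2 => //; exact: inU1.
    by apply/negP => /h3[/eqP|]; apply/negP.
  move=> x y xU yU; have [->|xw] := eqVneq x w.
    have [->|yw] := eqVneq y w; first by rewrite eqxx.
    by rewrite fw fx //; exact: main.
  have [->|yw] := eqVneq y w.
    rewrite fw fx // eq_sym [[set f x; f v]]setUC [[set x; w]]setUC; exact: main.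
  by rewrite !fx // => *; apply: addw => //; apply: h2 => //; apply: inU1.
- have EP x y : [set x; y] \in E -> [set x; y] = [set v; w] \/
      [/\ [set x; y] \in F, x != w & y != w].
    rewrite EF in_setU1 => /orP[/eqP|xyF]; first by left.
    by right; have [] := isolated_neq iw xyF.
  split.
    move=> x y /EP[/set2P_or[[-> ->]|[-> ->]]|[xyF xw yw]].
    + by left; rewrite fv fw.
    + by left; rewrite fv fw.
    + by rewrite !fx //; exact: h3.
  move=> x y s xyE fe sU; have sw : s != w by apply: contraNneq sU => ->.
  have sF := supported_isolated sE sU.
  have {}sF : isolated_in F s by apply: isolated_subset sF; exact: subD1set.
  have sv : v != s by apply: contraNneq sU => <-.
  (* Doubling the leaf edge amounts to hanging a triangle at [v] in place of the leaf. *)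
  have tri : pl ([set s; v] |: ([set s; w] |: E)).
    have := drawable_pendant_triangle (drawable_sub (subD1set _ _) pE) iw sF vw sv.
    rewrite eq_sym => /(_ sw); apply: drawable_sub.
    rewrite EF [[set s; v]]setUC [[set s; w]]setUC.
    by apply/subsetP => e; rewrite !inE; do 3 case: eqP => //.
  case: (EP x y xyE) => [/set2P_or[[-> ->]|[-> ->]]|[xyF xw yw]] //.
    by rewrite setUCA.
  rewrite !fx // in fe; rewrite EF.
  rewrite (setUCA [set [set s; y]]) (setUCA [set [set s; x]]).
  apply: drawable_pendant => //; first by apply: h4 => //; rewrite !inE negb_and sU orbT.
  by do 2 apply: isolated_add => //.
Qed.

End Reduction.

(** * Shortening a long path of vertices of degree two *)

Section Smoothing.
Variables (R : realType) (V : finType).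
Implicit Types (E F X : {set {set V}}) (U : {set V}).
Local Notation pl := (drawable R).

Lemma drawable_neq E x y : pl E -> [set x; y] \in E -> x != y.
Proof. by move=> [p [a D]]; exact: drawing_neq D. Qed.

Lemma degree2_sym E u w v : degree2 E u w v -> degree2 E v w u.
Proof.
case=> h1 h2 uv only; split; rewrite 1?eq_sym // 1?setUC //.
by move=> e eE /only[]// ->; rewrite setUC; [right|left].
Qed.

Lemma smooth_isolated E u w v : degree2 E u w v ->
  isolated_in (E :\ [set u; w] :\ [set w; v]) w.
Proof.
move=> [_ _ _ only] e; rewrite !inE => /and3P[e1 e2 eE].
by apply/negP => /(only _ eE)[] ee; rewrite ee eqxx in e1 e2.
Qed.

Ltac absurd_neq := match goal with H : is_true (?x != ?x) |- _ =>
  by rewrite eqxx in H end.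
Ltac set2_ne := apply/eqP => /set2P_or[[? ?]|[? ?]]; subst; absurd_neq.

(* Smooth [u] and [w] away and put them back at the ends of a chord of the edge
   [tv]. *)
Lemma parallel_edge E t u w v s : pl E -> degree2 E t u w -> degree2 E u w v ->
  t != v -> [set t; v] \notin E -> isolated_in E s ->
  pl ([set s; u] |: ([set s; w] |: E)).
Proof.
move=> pE du dw tv tvE is_.
have [tuE uwE tw onlyu] := du; have [_ wvE uv onlyw] := dw.
have tu := drawable_neq pE tuE; have uw := drawable_neq pE uwE.
have wv := drawable_neq pE wvE.
have [ts us] := isolated_neq is_ tuE; have [ws vs] := isolated_neq is_ wvE.
have uvE : [set u; v] \notin E.
  apply/negP => /onlyu []; rewrite ?inE ?eqxx // => /set2P_or[[? ?]|[? ?]];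
    subst; absurd_neq.
set S1 := [set u; v] |: (E :\ [set u; w] :\ [set w; v]).
have pS1 : pl S1 by apply: drawable_smooth.
have tuS : [set t; u] \in S1.
  by rewrite !inE tuE andbT; apply/orP; right; apply/andP; split; set2_ne.
set S2 := [set t; v] |: (S1 :\ [set t; u] :\ [set u; v]).
have pS2 : pl S2.
  apply: drawable_smooth => //; first exact: setU11.
  move=> e; rewrite !inE => /orP[/eqP ->|/and3P[_ e2 /onlyu h] /h[]]; first by right.
    by left.
  by move=> ee; rewrite ee eqxx in e2.
have is2 : isolated_in S2 s.
  apply: isolated_add => //.
  apply: isolated_subset is_; apply/subsetP => e.
  rewrite !inE => /and3P[e1 e2 /orP[/eqP e3|/and3P[//]]].
  by rewrite e3 eqxx in e1.
have iu2 : isolated_in S2 u.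
  apply: isolated_add => //; last by rewrite eq_sym.
  move=> e; rewrite !inE => /and3P[e1 e2 /orP[/eqP e3|/and3P[_ e4 /onlyu h]]].
    by rewrite e3 eqxx in e1.
  by apply/negP => /h[] ee; [rewrite ee eqxx in e2|rewrite ee eqxx in e4].
have iw2 : isolated_in S2 w.
  apply: isolated_add => //; last by rewrite eq_sym.
  move=> e; rewrite !inE => /and3P[e1 e2 /orP[/eqP e3|/and3P[e3 e4 /onlyw h]]].
    by rewrite e3 eqxx in e1.
  by apply/negP => /h[] ee; [rewrite ee eqxx in e4|rewrite ee eqxx in e3].
have sw : s != w by rewrite eq_sym.
have := drawable_triangle_on_edge pS2 (setU11 _ _) iu2 is2 iw2 us sw uw.
apply: drawable_sub; apply/subsetP => e; rewrite !inE [[set u; s]]setUC.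
case/orP=> [->|]; first by rewrite !orbT.
case/orP=> [->|eE]; first by rewrite !orbT.
have etv : e != [set t; v] by apply: contraNneq tvE => <-.
have euv : e != [set u; v] by apply: contraNneq uvE => <-.
rewrite eE (negbTE etv) (negbTE euv) /=.
by do 5 (case: eqP => //= _).
Qed.

(** Three vertices of degree two in a row: when the middle one is smoothed away, both of its edges
    may have to be doubled, and [parallel_edge] needs both ends of the doubled edge to have degree
    two. The two inequalities exclude cycles of length three and four. *)
Definition bare_path E t u w v v' :=
  [/\ degree2 E t u w, degree2 E u w v, degree2 E w v v', t != v &
      t != v'].

Lemma smooth_supported E U u w v : supported E U -> degree2 E u w v ->
  supported ([set u; v] |: (E :\ [set u; w] :\ [set w; v])) (U :\ w).
Proof.
move=> sE dw; have iw := smooth_isolated dw; case: dw => uwE wvE uv _.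
have [uw uU wU] := supported_pair sE uwE; have [wv _ vU] := supported_pair sE wvE.
move=> e; rewrite in_setU1 => /orP[/eqP ->|eF].
  by rewrite cards2 uv subUset !sub1set !inE uw uU [v == w]eq_sym wv vU.
have eE : e \in E by move: eF; rewrite !inE => /and3P[].
have [e2 /subsetP eU] := sE e eE; split => //.
apply/subsetP => x xe; rewrite !inE eU // andbT.
by apply: contraTneq xe => ->; exact: iw.
Qed.

(** The smoothed vertex [w] joins the class of [u]. Edges away from [w] are transferred by
    subdividing the edge from [u] to [v]; edges at [w] come from edges at [u], by letting [w] take
    over the place of [u] on the path. *)
Lemma smooth_step E U E0 U0 f t u w v v' : supported E U -> pl E ->
  bare_path E t u w v v' ->
  label_reduction R ([set u; v] |: (E :\ [set u; w] :\ [set w; v])) (U :\ w) E0 U0 f ->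
  label_reduction R E U E0 U0 (upd f w (f u)).
Proof.
move=> sE pE [du dw dv tv tv'].
have [tuE uwE tw onlyu] := du; have [_ wvE uv onlyw] := dw.
have [_ vv'E wv' onlyv] := dv.
have iwF := smooth_isolated dw.
have [F FE] : {F | F = E :\ [set u; w] :\ [set w; v]} by eexists.
have inF e : (e \in F) = [&& e != [set w; v], e != [set u; w] & e \in E].
  by rewrite FE !inE.
rewrite -FE in iwF *; set E1 := [set u; v] |: F.
move=> [[U0U fU fid] [sE0 pE0 card] h1 h2 [h3 h4]].
have [tu tU uU] := supported_pair sE tuE; have [uw _ wU] := supported_pair sE uwE.
have [wv _ vU] := supported_pair sE wvE; have [vv' _ v'U] := supported_pair sE vv'E.
have uvE : [set u; v] \notin E.
  apply/negP => /onlyu []; rewrite ?inE ?eqxx // => /set2P_or[[? ?]|[? ?]];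
    subst; absurd_neq.
have tvE : [set t; v] \notin E.
  apply/negP => /onlyv []; rewrite ?inE ?eqxx ?orbT // => /set2P_or[[? ?]|[? ?]];
    subst; absurd_neq.
have v'uE : [set v'; u] \notin E.
  apply/negP => /onlyu []; rewrite ?inE ?eqxx ?orbT // => /set2P_or[[? ?]|[? ?]];
    subst; absurd_neq.
have wvuw : [set w; v] != [set u; w] by set2_ne.
have EF : E = [set u; w] |: ([set w; v] |: F).
  by rewrite FE setD1K ?setD1K // !inE wvuw.
have uvF : [set u; v] \notin F by rewrite inF (negbTE uvE) !andbF.
have iwE1 : isolated_in E1 w by apply: isolated_add => //; rewrite eq_sym.
have tuF : [set t; u] \in F.
  by rewrite inF tuE andbT; apply/andP; split; set2_ne.
have inU1 x : x \in U -> x != w -> x \in U :\ w by rewrite !inE => -> ->.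
have fw : upd f w (f u) w = f u by rewrite upd_id.
have fx x : x != w -> upd f w (f u) x = f x by move=> xw; rewrite upd_ne.
have w0 : w \notin U0 by apply/negP => /(subsetP U0U); rewrite !inE eqxx.
have lift X : pl (X :|: E1) -> isolated_in X w -> [set u; v] \notin X ->
    pl (X :|: E).
  move=> h iX uvX; rewrite /E1 setUCA in h.
  rewrite EF (setUCA X) (setUCA X); apply: subdivide_edge => //.
    by rewrite in_setU (negbTE uvX).
  by apply: isolated_add; [exact: isolatedU|exact: uw|rewrite eq_sym].
have addw x y : x != w -> y != w -> [set x; y] != [set u; v] ->
    pl ([set x; y] |: E1) -> pl ([set x; y] |: E).
  move=> xw yw ne h; apply: lift => //; last by rewrite inE eq_sym.
  by move=> e; rewrite inE => /eqP ->; rewrite !inE negb_or ![w == _]eq_sym xw.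
have [sw [swu sww swx]] : exists sw : V -> V, [/\ sw u = w, sw w = u &
    forall x, x != u -> x != w -> sw x = x].
  exists (fun x => if x == u then w else if x == w then u else x).
  rewrite !eqxx [w == u]eq_sym (negbTE uw); split => // x.
  by move=> /negbTE -> /negbTE ->.
have swK : involutive sw.
  move=> x; have [->|xu] := eqVneq x u; first by rewrite swu sww.
  have [->|xw] := eqVneq x w; first by rewrite sww swu.
  by rewrite swx swx.
have sw2 x y : sw @: [set x; y] = [set sw x; sw y] by rewrite imsetU1 imset_set1.
have vu : v != u by rewrite eq_sym.
have vw : v != w by rewrite eq_sym.
have rename X : pl (X :|: E1) -> pl ([set sw @: e | e : {set V} in X] :|:
     ([set w; v] |: ([set t; w] |: (F :\ [set t; u])))).
  move=> /(drawable_rename swK); apply: drawable_sub.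
  rewrite imsetU setUS //; apply/subsetP => e; rewrite !inE => h; apply/imsetP.
  exists (sw @: e); last first.
    by rewrite -imset_comp -[LHS]imset_id; apply: eq_imset => x /=; rewrite swK.
  case/or3P: h => [/eqP ->|/eqP ->|].
  - by rewrite sw2 sww swx // setU11.
  - by rewrite sw2 sww swx // /E1 in_setU1 tuF orbT.
  case/andP=> etu eF; rewrite /E1 in_setU1; apply/orP; right.
  rewrite (_ : sw @: e = e) //.
  have we := iwF _ eF.
  have ue : u \notin e.
    move: eF; rewrite inF => /and3P[_ e1 eE]; apply/negP => /(onlyu _ eE)[] ee.
      by rewrite ee eqxx in etu.
    by rewrite ee eqxx in e1.
  rewrite -[RHS]imset_id; apply: eq_in_imset => x xe.
  by rewrite swx //; apply: contraTneq xe => ->.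
have iuF : isolated_in (F :\ [set t; u]) u.
  move=> e; rewrite !inE inF => /and4P[e1 _ e2 eE]; apply/negP => /(onlyu _ eE)[] ee.
    by rewrite ee eqxx in e1.
  by rewrite ee eqxx in e2.
(* exchange the names [u] and [w], then put [u] back on the edge [tw] *)
have attach y : y != u -> y != v -> y != t -> y != w -> pl ([set u; y] |: E1) ->
    pl ([set w; y] |: E).
  move=> yu yv yt yw /rename; rewrite imset_set1 sw2 swu swx // => h.
  have twS : [set t; w] \in [set w; y] |: ([set w; v] |: ([set t; w] |: (F :\ [set t; u]))).
    by rewrite !inE eqxx !orbT.
  have wu : w != u by rewrite eq_sym.
  have iu : isolated_in
      ([set w; y] |: ([set w; v] |: ([set t; w] |: (F :\ [set t; u])))) u.
    by do 3 apply: isolated_add => //.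
  have := drawable_subdivide h twS iu; apply: drawable_sub; apply/subsetP => e.
  have ne1 : [set w; y] != [set t; w] by set2_ne.
  have ne2 : [set w; v] != [set t; w] by set2_ne.
  rewrite EF !inE; case: (e =P [set u; w]) => [->|_]; first by rewrite !orbT.
  case: (e =P [set w; y]) => [->|_ /=]; first by rewrite ne1 !orbT.
  case: (e =P [set w; v]) => [->|_ /=]; first by rewrite ne2 !orbT.
  case: (e =P [set t; u]) => //= _; case: (e =P [set t; w]) => [->|_ /=].
    by move=> /iwF; rewrite !inE eqxx orbT.
  by move=> ->; rewrite ?orbT.
split.
- split.
  + by apply: subset_trans U0U _; exact: subD1set.
  + move=> x xU; have [->|xw] := eqVneq x w; first by rewrite fw fU // inU1.
    by rewrite fx // fU // inU1.
  + by move=> x xU0; rewrite fx ?fid //; apply: contraNneq w0 => <-.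
- have cE : #|E| = #|F|.+2.
    by rewrite FE (cardsD1 [set u; w] E) uwE (cardsD1 [set w; v] (_ :\ _)) !inE wvuw wvE.
  split => //; move: card; rewrite (cardsD1 w U) wU /E1 cardsU1 uvF cE.
  by rewrite /= !add1n addnS => ->; rewrite !addSn.
- have main y : y \in U -> w != y -> f u = f y -> pl ([set w; y] |: E).
    move=> yU; rewrite eq_sym => yw fe.
    have [->|yu] := eqVneq y u.
      by apply: drawable_sub pE; rewrite subUset subxx andbT sub1set setUC.
    have [->|yv] := eqVneq y v.
      by apply: drawable_sub pE; rewrite subUset subxx andbT sub1set.
    have [yt|yt] := eqVneq y t; last first.
      by apply: attach => //; apply: h1; rewrite ?inU1 // eq_sym.
    rewrite yt in fe *.
    (* Here [t] is already adjacent to [u]. Doubling that edge with [w] as the middle vertex and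
       then exchanging [u] and [w] yields all edges of [E] together with the one from [w] to [t]. *)
    have tuE1 : [set t; u] \in E1 by rewrite in_setU1 tuF orbT.
    have := h4 _ _ w tuE1 (esym fe); rewrite !inE eqxx => /(_ isT).
    rewrite setUA => /rename; rewrite imsetU1 imset_set1 !sw2 sww swu swx //.
    apply: drawable_sub; rewrite EF; apply/subsetP => e; rewrite !inE.
    case: (e =P [set u; w]) => [->|_]; first by rewrite ?orbT.
    case: (e =P [set w; v]) => [->|_ /=]; first by rewrite ?orbT.
    rewrite [[set w; t]]setUC [[set u; t]]setUC.
    case: (e =P [set t; w]) => [->|_ /=]; first by rewrite ?orbT.
    by case: (e =P [set t; u]).
  move=> x y xU yU xy; have [xw|xw] := eqVneq x w.
    by rewrite xw fw in xy *; rewrite fx 1?eq_sym // => fe; exact: main.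
  have [yw|yw] := eqVneq y w.
    move: xy; rewrite yw fw fx // [[set x; w]]setUC eq_sym => wx fe.
    exact: main (esym fe).
  rewrite !fx // => fe; have [e|ne] := eqVneq [set x; y] [set u; v].
    (* The smoothed graph contains this edge already, so it cannot be added there. Instead it is
       doubled: the copy through [w] restores the path, and the edge itself is the one wanted. *)
    have fuv : f u = f v by case/set2P_or: e => -[<- <-].
    have := h4 u v w (setU11 _ _) fuv; rewrite !inE eqxx => /(_ isT).
    rewrite e EF /E1; apply: drawable_sub; apply/subsetP => e'.
    rewrite !inE [[set w; u]]setUC.
    by case/or4P => ->; rewrite ?orbT.
  by apply: addw => //; apply: h1 => //; apply: inU1.
- have main y : y \in U -> y != w -> f u != f y -> [set f u; f y] \notin E0 ->
      pl ([set f u; f y] |: E0) -> pl ([set w; y] |: E).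
    move=> yU yw fe nE h.
    have nE1 : [set u; y] \notin E1 by apply/negP => /h3[/eqP|]; apply/negP.
    apply: attach => //; last by apply: h2 => //; exact: inU1.
    + by apply: contraNneq fe => ->.
    + by apply: contraNneq nE1 => ->; exact: setU11.
    + by apply: contraNneq nE1 => ->; rewrite setUC in_setU1 tuF orbT.
  move=> x y xU yU; have [->|xw] := eqVneq x w.
    have [->|yw] := eqVneq y w; first by rewrite eqxx.
    by rewrite fw fx //; exact: main.
  have [->|yw] := eqVneq y w.
    rewrite fw fx // eq_sym [[set f x; f u]]setUC [[set x; w]]setUC; exact: main.
  rewrite !fx // => fe nE h; apply: addw => //; last by apply: h2 => //; apply: inU1.
  apply/eqP => e; have xyE1 : [set x; y] \in E1 by rewrite e setU11.
  by case: (h3 _ _ xyE1) => [/eqP|]; apply/negP.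
have EP x y : [set x; y] \in E -> [\/ [set x; y] = [set u; w],
    [set x; y] = [set w; v] | [/\ [set x; y] \in F, x != w & y != w]].
  rewrite EF !in_setU1 => /or3P[/eqP|/eqP|xyF]; [by constructor 1|by constructor 2|].
  by constructor 3; have [] := isolated_neq iwF xyF.
have fuw : upd f w (f u) u = f u by rewrite fx.
have fvw : upd f w (f u) v = f v by rewrite fx.
split.
  move=> x y /EP[/set2P_or[[-> ->]|[-> ->]]|/set2P_or[[-> ->]|[-> ->]]|[xyF xw yw]].
  + by left; rewrite fw fuw.
  + by left; rewrite fw fuw.
  + by rewrite fw fvw; apply: h3; exact: setU11.
  + by rewrite fw fvw; apply: h3; rewrite setUC; exact: setU11.
  + by rewrite !fx //; apply: h3; rewrite in_setU1 xyF orbT.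
move=> x y s xyE fe sU; have sw_ : s != w by apply: contraNneq sU => ->.
have is_ := supported_isolated sE sU.
have puw := parallel_edge pE du dw tv tvE is_.
have v'u : v' != u by apply: contraNneq uvE => <-; rewrite setUC.
have pwv := parallel_edge pE (degree2_sym dv) (degree2_sym dw) v'u v'uE is_.
case: (EP x y xyE) =>
  [/set2P_or[[-> ->]|[-> ->]]|/set2P_or[[-> ->]|[-> ->]]|[xyF xw yw]] //.
- by rewrite setUCA.
- by rewrite setUCA.
rewrite !fx // in fe; rewrite setUA; apply: lift.
- by rewrite -setUA; apply: h4 => //; rewrite ?in_setU1 ?xyF ?orbT // !inE negb_and sU orbT.
- move=> e; rewrite !inE => /orP[]/eqP ->; rewrite !inE negb_or ![w == _]eq_sym;
    by rewrite sw_.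
- rewrite !inE negb_or; apply/andP; split; apply/negP => /eqP /esym/set2P_or[][e1 e2];
    by move: sU; rewrite ?e1 ?e2 ?uU ?vU.
Qed.
End Smoothing.

(** * Irreducible graphs *)

Section Terminal.
Local Open Scope nat_scope.
Variables (R : realType) (V : finType).
Implicit Types (E F X : {set {set V}}) (U : {set V}).
Local Notation pl := (drawable R).

Lemma leaf_supported E U v w : supported E U -> leaf E v w ->
  supported (E :\ [set v; w]) (U :\ w).
Proof.
move=> sE [vwE only] e; rewrite !inE => /andP[ne eE]; have [e2 /subsetP eU] := sE e eE.
split => //; apply/subsetP => x xe; rewrite !inE eU // andbT.
by apply: contraNneq ne => xw; apply/eqP/only; rewrite -?xw.
Qed.

Lemma label_reduction_exists E U : supported E U -> pl E ->
  exists E0 U0 f, [/\ label_reduction R E U E0 U0 f,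
    forall v w, ~ leaf E0 v w & forall t u w v v', ~ bare_path E0 t u w v v'].
Proof.
have [n] := ubnP #|U|; elim: n E U => // n IH E U Un sE pE.
have [[v [w lvw]]|nl] := pselect (exists v w, leaf E v w).
  have [|||E0 [U0 [f [h1 h2 h3]]]] := IH (E :\ [set v; w]) (U :\ w).
  - have [_ _ wU] := supported_pair sE lvw.1.
    by move: Un; rewrite (cardsD1 w U) wU.
  - exact: leaf_supported.
  - by apply: drawable_sub pE; exact: subD1set.
  by exists E0, U0, (upd f w (f v)); split => //; exact: leaf_step.
have [[t [u [w [v [v' bp]]]]]|nb] :=
  pselect (exists t u w v v', bare_path E t u w v v').
  have [_ dw _ _ _] := bp; have [uwE wvE uv only] := dw.
  have [|||E0 [U0 [f [h1 h2 h3]]]] :=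
    IH ([set u; v] |: (E :\ [set u; w] :\ [set w; v])) (U :\ w).
  - have [_ _ wU] := supported_pair sE uwE.
    by move: Un; rewrite (cardsD1 w U) wU.
  - exact: smooth_supported.
  - exact: drawable_smooth.
  by exists E0, U0, (upd f w (f u)); split => //; exact: smooth_step bp h1.
exists E, U, id; split; first exact: label_reduction_id.
  by move=> v w h; apply: nl; exists v, w.
by move=> t u w v v' h; apply: nb; exists t, u, w, v, v'.
Qed.

Definition nbhd E (x : V) := [set y | [set x; y] \in E].

Definition eadj E : rel V := fun x y => [set x; y] \in E.

Definition component_of E (x : V) := [set y | connect (eadj E) x y].

Lemma eadj_sym E : connect_sym (eadj E).
Proof. by apply: sym_connect_sym => x y; rewrite /eadj setUC. Qed.

Lemma comp_subset E (S : {set V}) a : a \in S ->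
  (forall x y, [set x; y] \in E -> x \in S -> y \in S) -> component_of E a \subset S.
Proof.
move=> aS h; apply/subsetP => b; rewrite inE => ab.
have cl : fingraph.closed (eadj E) [in S].
  by apply: intro_closed; [exact: eadj_sym|exact: h].
have e : (a \in S) = (b \in S) := closed_connect cl ab.
by rewrite -e.
Qed.

Lemma card_nbhd E U x : supported E U -> #|nbhd E x| = #|[set e in E | x \in e]|.
Proof.
move=> sE; rewrite -(card_in_imset (f := fun y => [set x; y]) (D := nbhd E x)).
  apply: eq_card => e; apply/imsetP/idP => [[y]|]; rewrite inE.
    by move=> xyE ->; rewrite inE xyE !inE eqxx.
  case/andP=> eE; have [y [z [e_ yz _ _]]] := supported_ends sE eE.
  rewrite e_ in eE *; rewrite !inE => /orP[]/eqP ->.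
    by exists z; rewrite // inE.
  by exists y; rewrite ?inE setUC.
move=> y z; rewrite !inE => xyE _ /set2P_or[[_ //]|[-> ->]] //.
Qed.

Lemma handshake E U : supported E U -> (\sum_(x in U) #|nbhd E x| = #|E| * 2)%N.
Proof.
move=> sE; under eq_bigr do rewrite (card_nbhd _ sE) -sum1_card big_mkcond /=.
rewrite exchange_big /= (bigID (mem E)) /= [X in (_ + X)%N]big1 ?addn0; last first.
  by move=> e /negbTE eE; rewrite big1 // => x _; rewrite inE eE.
rewrite -sum_nat_const; apply: eq_bigr => e eE; have [e2 /subsetP eU] := sE e eE.
rewrite -[RHS]e2 -sum1_card [RHS]big_mkcond /= big_mkcond; apply: eq_bigr => x _ /=.
rewrite inE eE /=; case: (boolP (x \in e)) => [/eU -> //|_]; by case: ifP.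
Qed.

Lemma degree2P E U u w v : supported E U -> nbhd E w = [set u; v] -> u != v ->
  degree2 E u w v.
Proof.
move=> sE nw uv.
have inN y : ([set w; y] \in E) = (y \in [set u; v]) by rewrite -nw inE.
have uE : [set w; u] \in E by rewrite inN !inE eqxx.
have vE : [set w; v] \in E by rewrite inN !inE eqxx orbT.
have nwP y : [set w; y] \in E -> y = u \/ y = v.
  by rewrite inN !inE => /orP[]/eqP; [left|right].
split => //; first by rewrite setUC.
move=> e eE we.
have [x [y [e_ xy _ _]]] := supported_ends sE eE; rewrite e_ in eE we *.
move: we; rewrite !inE => /orP[]/eqP ww; subst.
  by case: (nwP _ eE) => ->; [left; rewrite setUC|right].
by rewrite setUC in eE; case: (nwP _ eE) => ->; [left|right; rewrite setUC].
Qed.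

Lemma nbhd_degree2 E u w v : degree2 E u w v -> nbhd E w = [set u; v].
Proof.
move=> [uwE wvE uv only]; apply/setP => y; rewrite !inE; apply/idP/orP.
  move=> /only; rewrite !inE eqxx => /(_ isT)[]/set2P_or[[e1 e2]|[e1 e2]].
  - by left; rewrite e2 e1.
  - by left; rewrite e2.
  - by right; rewrite e2.
  - by right; rewrite e2 e1.
by case=> /eqP ->; rewrite // setUC.
Qed.

(** The bound 4 admits the cycles too short to contain a [bare_path]; isolated vertices, triangles
    and squares are the components that arise in [joinable_or_near]. *)
Definition joinable E U := [set a in U | (#|component_of E a| <= 4) &&
  [forall b in U, (b \notin component_of E a) ==> `[< pl ([set a; b] |: E) >]]].

Lemma joinable_intro E U (S : {set V}) a : a \in U -> a \in S -> (#|S| <= 4)%N ->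
  (forall x y, [set x; y] \in E -> x \in S -> y \in S) ->
  (forall x, x \in S -> connect (eadj E) a x) ->
  (forall b, b \notin S -> pl ([set a; b] |: E)) -> a \in joinable E U.
Proof.
move=> aU aS S4 cl co h; rewrite inE aU /=; apply/andP; split.
  exact: leq_trans (subset_leq_card (comp_subset aS cl)) S4.
apply/forall_inP => b bU; apply/implyP => nb; apply/asboolP/h.
by apply: contra nb => /co; rewrite inE.
Qed.

(** Erase the component, hang [a] on [b], and rebuild the triangle as a pendant triangle at [a]. *)
Lemma join_triangle E u a v b : pl E -> degree2 E v u a -> degree2 E u a v ->
  degree2 E a v u -> b \notin [set u; a; v] -> pl ([set a; b] |: E).
Proof.
move=> pE [vuE uaE va onlyu] [_ avE uv onlya] [_ _ au onlyv].
rewrite !inE !negb_or => /andP[/andP[bu ba] bv].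
pose F := [set e in E | [&& u \notin e, a \notin e & v \notin e]].
have FE : F \subset E by apply/subsetP => e; rewrite inE => /andP[].
have iF x : x \in [set u; a; v] -> isolated_in F x.
  move=> xS e; rewrite inE => /and4P[_ e1 e2 e3]; move: xS.
  by rewrite !inE -orbA => /or3P[]/eqP ->.
have au' : u != a by rewrite eq_sym.
have p1 : pl ([set b; a] |: F).
  by apply: drawable_pendant => //; [exact: drawable_sub pE|];
    apply: iF; rewrite !inE eqxx orbT.
have i1 : isolated_in ([set b; a] |: F) u.
  by apply: isolated_add => //; apply: iF; rewrite !inE eqxx.
have i2 : isolated_in ([set b; a] |: F) v.
  by apply: isolated_add; rewrite // 1?eq_sym //; apply: iF; rewrite !inE eqxx orbT.
have av : a != v by rewrite eq_sym.
have := drawable_pendant_triangle p1 i1 i2 au av uv.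
apply: drawable_sub; apply/subsetP => e; rewrite !inE [[set b; a]]setUC.
case/orP=> [->|eE]; first by rewrite !orbT.
have [/(onlyu _ eE)[]->|ue] := boolP (u \in e).
- by rewrite [[set v; u]]setUC eqxx !orbT.
- by rewrite [[set u; a]]setUC eqxx.
have [/(onlya _ eE)[]->|ae] := boolP (a \in e).
- by rewrite [[set u; a]]setUC eqxx.
- by rewrite eqxx !orbT.
have [/(onlyv _ eE)[]->|ve] := boolP (v \in e).
- by rewrite eqxx !orbT.
- by rewrite [[set v; u]]setUC eqxx !orbT.
by rewrite eE !orbT.
Qed.

(** As for a triangle on [u], [a], [v], whose side opposite to [a] is finally subdivided by [t]. *)
Lemma join_square E u a v t b : pl E -> degree2 E t u a -> degree2 E u a v ->
  degree2 E a v t -> degree2 E v t u -> b \notin [set u; a; v; t] ->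
  pl ([set a; b] |: E).
Proof.
move=> pE du da dv dt.
have [tuE uaE ta onlyu] := du; have [_ avE uv onlya] := da.
have [_ vtE at_ onlyv] := dv; have [_ _ vu onlyt] := dt.
rewrite !inE !negb_or => /andP[/andP[/andP[bu ba] bv] bt].
have ua := drawable_neq pE uaE; have av := drawable_neq pE avE.
have tu := drawable_neq pE tuE; have vt := drawable_neq pE vtE.
pose F := [set e in E | [&& u \notin e, a \notin e, v \notin e & t \notin e]].
have FE : F \subset E by apply/subsetP => e; rewrite inE => /andP[].
have iF x : x \in [set u; a; v; t] -> isolated_in F x.
  move=> xS e; rewrite inE => /and5P[_ e1 e2 e3 e4]; move: xS.
  by rewrite !inE -!orbA => /or4P[]/eqP ->.
have p1 : pl ([set b; a] |: F).
  by apply: drawable_pendant => //; [exact: drawable_sub pE|];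
    apply: iF; rewrite !inE eqxx !orbT.
have i1 : isolated_in ([set b; a] |: F) u.
  by apply: isolated_add; rewrite // 1?eq_sym //; apply: iF; rewrite !inE eqxx.
have i2 : isolated_in ([set b; a] |: F) v.
  by apply: isolated_add; rewrite // 1?eq_sym //; apply: iF; rewrite !inE eqxx !orbT.
have au : a != u by rewrite eq_sym.
have p2 := drawable_pendant_triangle p1 i1 i2 au av uv.
have i3 : isolated_in ([set a; u] |: ([set a; v] |: ([set u; v] |: ([set b; a] |: F)))) t.
  do 4 (apply: isolated_add; rewrite // 1?eq_sym //).
  by apply: iF; rewrite !inE eqxx !orbT.
have uvT : [set u; v] \in [set a; u] |: ([set a; v] |: ([set u; v] |: ([set b; a] |: F))).
  by rewrite !inE eqxx !orbT.
have nv e : e \in E -> e != [set u; v].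
  move=> eE; apply/eqP => ee; rewrite ee in eE.
  have := onlyu _ eE; rewrite !inE eqxx => /(_ isT)[]/set2P_or[[e1 e2]|[e1 e2]];
  by move: tu vu at_ av ua vt; rewrite ?e1 ?e2 ?eqxx.
have := drawable_subdivide p2 uvT i3.
apply: drawable_sub; apply/subsetP => e; rewrite !inE [[set b; a]]setUC.
case/orP=> [/eqP ->|eE].
  rewrite eqxx !orbT andbT; apply/orP; right; apply/orP; right.
  by apply/eqP => /set2P_or[[e1 e2]|[e1 e2]]; move: ua av; rewrite e1 eqxx.
rewrite (nv e eE) /=.
have [/(onlyu _ eE)[]->|ue] := boolP (u \in e).
- by rewrite [[set t; u]]setUC eqxx.
- by rewrite [[set u; a]]setUC eqxx !orbT.
have [/(onlya _ eE)[]->|ae] := boolP (a \in e).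
- by rewrite [[set u; a]]setUC eqxx !orbT.
- by rewrite eqxx !orbT.
have [/(onlyv _ eE)[]->|ve] := boolP (v \in e).
- by rewrite eqxx !orbT.
- by rewrite [[set v; t]]setUC eqxx !orbT.
have [/(onlyt _ eE)[]->|te] := boolP (t \in e).
- by rewrite [[set v; t]]setUC eqxx !orbT.
- by rewrite [[set t; u]]setUC eqxx.
by rewrite eE !orbT.
Qed.
End Terminal.

(** * The size of a graph with no leaf and no long path *)

Section Bound.
Local Open Scope nat_scope.
Variables (R : realType) (V : finType).
Implicit Types (E F X : {set {set V}}) (U : {set V}).
Local Notation pl := (drawable R).

Section Terminal.
Variables (E : {set {set V}}) (U : {set V}).
Hypotheses (sE : supported E U) (pE : pl E).
Hypotheses (no_leaf : forall v w, ~ leaf E v w)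
  (no_path : forall t u w v v', ~ bare_path E t u w v v').

Let B := [set b in U | 2 < #|nbhd E b|].
Let B1 := \bigcup_(b in B) nbhd E b.
Let B2 := \bigcup_(c in B1 | #|nbhd E c| <= 2) nbhd E c.

Lemma nbhdC x y : (x \in nbhd E y) = (y \in nbhd E x).
Proof. by rewrite !inE setUC. Qed.

Lemma nbhd_neq1 x : #|nbhd E x| != 1.
Proof.
apply/negP => /cards1P[v nx]; apply: (@no_leaf v x).
have inN y : ([set x; y] \in E) = (y == v) by rewrite -in_set1 -nx inE.
split; first by rewrite setUC inN.
move=> e eE xe; have [y [z [e_ yz _ _]]] := supported_ends sE eE.
move: xe eE; rewrite e_ !inE => /orP[]/eqP <-; first by rewrite inN setUC => /eqP ->.
by rewrite setUC inN => /eqP ->; rewrite setUC.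
Qed.

Lemma nbhd_deg2 x u : #|nbhd E x| <= 2 -> u \in nbhd E x ->
  exists v, degree2 E u x v.
Proof.
move=> d2 ux; have n1 := nbhd_neq1 x.
have n0 : #|nbhd E x| != 0 by rewrite cards_eq0; apply/set0Pn; exists u.
have /eqP/cards2P[y [z [yz nx]]] : #|nbhd E x| = 2.
  by move: d2 n0 n1; case: #|_| => [|[|[|]]].
have := degree2P sE nx yz; move: ux; rewrite nx !inE => /orP[]/eqP -> h.
  by exists z.
by exists y; exact: degree2_sym.
Qed.

(** Away from vertices of degree at least three, [a] is isolated or is the middle of a path of
    vertices of degree two. In the absence of a [bare_path] this path closes up to a triangle or a
    square. *)
Lemma joinable_or_near a : a \in U -> a \notin joinable R E U ->
  a \in B :|: B1 :|: B2.
Proof.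
move=> aU aJ; apply/negPn/negP => aB; move/negP: aJ; apply; move: aB.
rewrite !in_setU !negb_or => /andP[/andP[aB aB1] aB2].
have inU x y : x \in nbhd E y -> x \in U.
  by rewrite inE => /(supported_pair sE)[].
have da : #|nbhd E a| <= 2 by move: aB; rewrite inE aU -leqNgt.
have nB x : x \in nbhd E a -> x \notin B.
  by move=> xa; apply: contra aB1 => xB; apply/bigcupP; exists x; rewrite // nbhdC.
have nB1 x : x \in nbhd E a -> #|nbhd E x| <= 2 -> x \notin B1.
  move=> xa dx; apply: contra aB2 => xB; apply/bigcupP.
  by exists x; rewrite ?xB // nbhdC.
have d2 x : x \in U -> x \notin B -> #|nbhd E x| <= 2.
  by move=> xU; rewrite inE xU -leqNgt.
have [n0|/set0Pn[u ua]] := eqVneq (nbhd E a) set0.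
  have ia : isolated_in E a.
    move=> e eE; have [y [z [e_ yz _ _]]] := supported_ends sE eE.
    rewrite e_ in eE *; rewrite !inE negb_or; apply/andP; split; apply/eqP => ay.
      by have : z \in set0; [rewrite -n0 inE ay|rewrite inE].
    by have : y \in set0; [rewrite -n0 inE ay setUC|rewrite inE].
  apply: (joinable_intro (S := [set a])) => //; rewrite ?in_set1 ?cards1 //.
  - move=> x y xyE; rewrite inE => /eqP xa; rewrite xa in xyE.
    have : y \in set0 by rewrite -n0 inE.
    by rewrite in_set0.
  - by move=> x; rewrite inE => /eqP ->; exact: connect0.
  - by move=> b; rewrite inE => ba; rewrite [[set a; b]]setUC; apply: drawable_pendant.
have [v dw] := nbhd_deg2 da ua.
have va : v \in nbhd E a by rewrite (nbhd_degree2 dw) !inE eqxx orbT.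
have du2 := d2 u (inU _ _ ua) (nB _ ua); have dv2 := d2 v (inU _ _ va) (nB _ va).
have [t dut] : exists t, degree2 E t u a.
  have [|t h] := @nbhd_deg2 u a du2; first by rewrite nbhdC.
  by exists t; exact: degree2_sym.
have [v' dv] : exists v', degree2 E a v v' by apply: nbhd_deg2 => //; rewrite nbhdC.
have tu : t \in nbhd E u by rewrite (nbhd_degree2 dut) !inE eqxx.
have [_ _ uv _] := dw.
have nu := nbhd_degree2 dut; have nv := nbhd_degree2 dv; have na := nbhd_degree2 dw.
have conn x y z : x \in nbhd E y -> connect (eadj E) z y -> connect (eadj E) z x.
  by rewrite inE => yx zy; apply: connect_trans zy _; exact: connect1.
have [tv|tv] := eqVneq t v.
  subst t; have v'u : v' = u.
    have : u \in nbhd E v by rewrite nbhdC.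
    rewrite nv !inE => /orP[]/eqP // ua'.
    by move: ua; rewrite ua' inE => /(supported_pair sE)[/eqP].
  subst v'; apply: (joinable_intro (S := [set u; a; v])) => //.
  - by rewrite !inE eqxx orbT.
  - by rewrite (leq_trans (leq_card_setU _ _)) // cards2 cards1; case: (_ != _).
  - move=> x y xyE xS; have : y \in nbhd E x by rewrite inE.
    move: xS; rewrite !(in_setU, in_set1) -orbA => /or3P[]/eqP ->;
      rewrite ?nu ?nv ?na !inE => /orP[]/eqP ->; by rewrite eqxx ?orbT.
  - move=> x; rewrite !inE -orbA => /or3P[]/eqP ->.
    + exact: conn ua _.
    + exact: connect0.
    + exact: conn va _.
  - by move=> b; exact: join_triangle.
have [tv'|tv'] := eqVneq t v'; last by case: (@no_path t u a v v').
subst v'; have tB : t \notin B.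
  by apply: contra (nB1 _ ua du2) => tB; apply/bigcupP; exists t; rewrite // nbhdC.
have [w dt] : exists w, degree2 E v t w.
  by apply: nbhd_deg2; [apply: d2 => //; exact: inU tu|rewrite nbhdC nv !inE eqxx orbT].
have wu : w = u.
  have : u \in nbhd E t by rewrite nbhdC.
  by rewrite (nbhd_degree2 dt) !inE => /orP[]/eqP // uv'; rewrite uv' eqxx in uv.
subst w; have nt := nbhd_degree2 dt.
apply: (joinable_intro (S := [set u; a; v; t])) => //.
- by rewrite !inE eqxx !orbT.
- rewrite (leq_trans (leq_card_setU _ _)) // cards1 addn1 ltnS.
  by rewrite (leq_trans (leq_card_setU _ _)) // cards2 cards1; case: (_ != _).
- move=> x y xyE xS; have : y \in nbhd E x by rewrite inE.
  move: xS; rewrite !(in_setU, in_set1) -!orbA => /or4P[]/eqP ->;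
    rewrite ?nu ?nv ?na ?nt !inE => /orP[]/eqP ->; by rewrite eqxx ?orbT.
- move=> x; rewrite !inE -!orbA => /or4P[]/eqP ->.
  + exact: conn ua _.
  + exact: connect0.
  + exact: conn va _.
  + exact: (conn _ _ _ tu (conn _ _ _ ua (connect0 _ _))).
- by move=> b; exact: join_square dut dw dv dt.
Qed.

Lemma card_bigcup_le (I : finType) (A : {pred I}) (F : I -> {set V}) :
  #|\bigcup_(i in A) F i| <= \sum_(i in A) #|F i|.
Proof.
elim/big_rec2: _ => [|i n S _ h]; first by rewrite cards0.
by rewrite (leq_trans (leq_card_setU _ _)) // leq_add2l.
Qed.

Lemma joinable_isolated a : a \in U -> #|nbhd E a| = 0 -> a \in joinable R E U.
Proof.
move=> aU /eqP; rewrite cards_eq0 => /eqP n0.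
apply/negPn/negP => /(joinable_or_near aU); rewrite !in_setU inE n0 cards0 andbF /=.
by case/orP => /bigcupP[x _]; rewrite nbhdC n0 inE.
Qed.

(** A vertex of degree d >= 3 accounts for at most 1 + d + 2d vertices near it, which is at most 10
    (d - 2), with equality for d = 3. The sum of d - 2 over these vertices is at most 2 (|E| - |U| +
    |J|), [J] being the set of joinable vertices, because isolated vertices are joinable. Hence |U|
    <= |J| + 20 (|E| - |U| + |J|). *)
Lemma terminal_bound : 21 * #|U| <= 21 * #|joinable R E U| + 20 * #|E|.
Proof.
pose J := joinable R E U; pose d x := #|nbhd E x|.
have hU : #|U| <= #|J| + (#|B| + #|B1| + #|B2|).
  have : U \subset J :|: (B :|: B1 :|: B2).
    apply/subsetP => a aU; rewrite in_setU; case: (boolP (a \in J)) => //= aJ.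
    exact: joinable_or_near.
  move/subset_leq_card/leq_trans; apply.
  apply: (leq_trans (leq_card_setU _ _)); rewrite leq_add2l.
  by apply: (leq_trans (leq_card_setU _ _)); rewrite leq_add2r leq_card_setU.
have h1 : #|B1| <= \sum_(b in B) d b by exact: card_bigcup_le.
have h2 : #|B2| <= 2 * #|B1|.
  apply: (leq_trans (card_bigcup_le _ _)).
  rewrite mulnC -sum_nat_const big_mkcondr; apply: leq_sum => c _.
  by case: ifP.
have h3 : #|B| + 3 * (\sum_(b in B) d b) <= 10 * \sum_(b in B) (d b - 2).
  rewrite -sum1_card !big_distrr /= -big_split /=; apply: leq_sum => b.
  by rewrite inE => /andP[_]; rewrite -/(d b) => ?; lia.
have h4 : \sum_(b in B) (d b - 2) + 2 * #|U| <= \sum_(x in U) d x + 2 * #|J|.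
  have -> : \sum_(b in B) (d b - 2) = \sum_(x in U) (d x - 2).
    rewrite [RHS](bigID (fun x => 2 < d x)) /= [X in _ + X]big1 ?addn0.
      by apply: eq_bigl => x; rewrite inE.
    by move=> x /andP[_]; rewrite -leqNgt => /eqP.
  have hJ : #|J| = \sum_(x in U) (x \in J).
    rewrite -sum1_card big_mkcond [RHS]big_mkcond; apply: eq_bigr => x _.
    case: (boolP (x \in J)) => xJ; last by case: ifP.
    by move: xJ; rewrite inE => /andP[->].
  rewrite hJ mulnC -sum_nat_const big_distrr /= -!big_split /=; apply: leq_sum => x xU.
  have n1 := nbhd_neq1 x; rewrite -/(d x) in n1.
  have : d x = 0 -> x \in J by exact: joinable_isolated.
  by case: (d x) n1 => [|[|n]] // _; [move=> ->|lia].
rewrite (handshake sE) in h4; rewrite -/J.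
move: h1 h2 h3 h4 hU; move: (\sum_(b in B) _) (\sum_(b in B) _) => a b.
clear; lia.
Qed.

End Terminal.
End Bound.

(** * Counting *)

Section Addable.
Local Open Scope nat_scope.
Variables (R : realType) (V : finType).
Implicit Types (E F X : {set {set V}}) (U C : {set V}).
Local Notation pl := (drawable R).

Lemma card_dep_pairs (S T : finType) (A : {set S}) (F : S -> {set T}) :
  #|[set p : S * T | (p.1 \in A) && (p.2 \in F p.1)]| = \sum_(x in A) #|F x|.
Proof.
under eq_bigr do rewrite -sum1_card.
by rewrite pair_big_dep /= -sum1_card; apply: eq_bigl => p; rewrite inE.
Qed.

Lemma card_edge_pairs (P : {set V * V}) (T : {set {set V}}) :
  (forall p, p \in P -> [set p.1; p.2] \in T) -> #|P| <= 2 * #|T|.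
Proof.
move=> PT.
have sub : P \subset \bigcup_(e in T) [set p in P | [set p.1; p.2] == e].
  apply/subsetP => p pP; apply/bigcupP; exists [set p.1; p.2]; first exact: PT.
  by rewrite inE pP eqxx.
apply: leq_trans (subset_leq_card sub) _; apply: leq_trans (card_bigcup_le _ _) _.
rewrite mulnC -sum_nat_const; apply: leq_sum => e _.
have [->|/set0Pn[[a b] ]] := eqVneq [set p in P | [set p.1; p.2] == e] set0.
  by rewrite cards0.
rewrite inE /= => /andP[_ /eqP <-].
apply: (@leq_trans #|[set (a, b); (b, a)]|); last by rewrite cards2; case: (_ != _).
apply/subset_leq_card/subsetP => -[c d]; rewrite !inE /= => /andP[_ /eqP].
by case/set2P_or => -[-> ->]; rewrite eqxx ?orbT.
Qed.

Definition addable E U := [set e : {set V} | [&& e \notin E, #|e| == 2,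
  e \subset U & `[< pl (e |: E) >]]].

Lemma addableP E U x y : x \in U -> y \in U -> x != y -> [set x; y] \notin E ->
  pl ([set x; y] |: E) -> [set x; y] \in addable E U.
Proof.
move=> xU yU xy nE h; rewrite inE nE cards2 xy subUset !sub1set xU yU /=.
exact/asboolP.
Qed.

Lemma comp_sym E a b : (a \in component_of E b) = (b \in component_of E a).
Proof. by rewrite !inE eadj_sym. Qed.

Lemma comp_trans E a b c :
  a \in component_of E b -> b \in component_of E c -> a \in component_of E c.
Proof. by rewrite !inE => h1 h2; exact: connect_trans h2 h1. Qed.

(** For each [y] the joinable vertices whose component contains [f y] all lie in one component, so
    at most 4 of them are lost. At least 2K remain for each [y], and an edge is counted at most
    twice. *)
Lemma addable_joinable E U E0 U0 f K : supported E U ->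
  label_reduction R E U E0 U0 f -> 2 * K + 4 <= #|joinable R E0 U0| ->
  K * #|U| <= #|addable E U|.
Proof.
move=> sE [[U0U fU fid] _ _ h2 [h3 _]] J4; set J := joinable R E0 U0 in J4 *.
have JU a : a \in J -> a \in U0 by rewrite inE => /andP[].
pose Q : {set V * V} := [set p | f p.2 \in component_of E0 p.1].
have c1 := cardsID Q (setX J U); rewrite cardsX in c1.
have hQ : #|setX J U :&: Q| <= 4 * #|U|.
  have sub : setX J U :&: Q \subset
      \bigcup_(y in U) (fun a => (a, y)) @: [set a in J | f y \in component_of E0 a].
    apply/subsetP => -[a y]; rewrite !inE /= => /andP[/andP[aJ yU] h].
    apply/bigcupP; exists y => //; apply/imsetP; exists a => //.
    by rewrite !inE aJ.
  apply: leq_trans (subset_leq_card sub) _; apply: leq_trans (card_bigcup_le _ _) _.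
  rewrite mulnC -sum_nat_const; apply: leq_sum => y _.
  apply: leq_trans (leq_imset_card _ _) _.
  have [->|/set0Pn[a]] := eqVneq [set a in J | f y \in component_of E0 a] set0.
    by rewrite cards0.
  rewrite inE => /andP[aJ ya].
  apply: (@leq_trans #|component_of E0 a|); last by move: aJ; rewrite inE => /and3P[].
  apply/subset_leq_card/subsetP => b; rewrite inE => /andP[_ yb].
  by apply: comp_trans ya; rewrite comp_sym.
have : #|setX J U :\: Q| <= 2 * #|addable E U|.
  apply: card_edge_pairs => -[a y]; rewrite inE in_setX /= => /andP[nQ /andP[aJ yU]].
  rewrite inE /= in nQ; have aU0 := JU _ aJ; have aU := subsetP U0U _ aU0.
  have fa := fid a aU0; have fyU := fU y yU.
  have ny : f a != f y by apply: contraNneq nQ => <-; rewrite fa inE connect0.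
  have nE : [set f a; f y] \notin E0.
    by apply: contra nQ; rewrite fa inE => h; exact: connect1.
  apply: addableP => //.
  - by apply: contraNneq ny => ->.
  - by apply/negP => /h3[/eqP|]; apply/negP.
  apply: h2 => //; rewrite fa; move: aJ; rewrite inE => /and3P[_ _ /forall_inP h].
  by have := h _ fyU; rewrite nQ => /asboolP.
move: c1 hQ J4; clear.
move: #|_ :&: _| #|_ :\: _| #|J| #|U| #|addable E U| => a b c d e; nia.
Qed.

(** By the Cauchy inequality at least (2K + 5) |U| ordered pairs lie within classes. The diagonal
    takes away |U| of them and the existing edges at most 4 |U|; the remaining 2K |U| pairs give
    every edge at most twice. *)
Lemma addable_labels E U E0 U0 f K : supported E U -> pl E ->
  label_reduction R E U E0 U0 f -> (2 * K + 5) * #|U0| <= #|U| ->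
  #|E| <= 2 * #|U| -> K * #|U| <= #|addable E U|.
Proof.
move=> sE pE [[U0U fU fid] _ h1 _ _] hU0 hE.
pose S : {set V * V} := [set p | [&& p.1 \in U, p.2 \in U & f p.1 == f p.2]].
pose c b := #|[set x in U | f x == b]|.
have cU : \sum_(b in U0) c b = #|U|.
  rewrite -[RHS]sum1_card [RHS](partition_big f (mem U0)) /=; last first.
    by move=> x xU; exact: fU.
  apply: eq_bigr => b _; rewrite /c -sum1_card; apply: eq_bigl => x.
  by rewrite inE.
have cS : \sum_(b in U0) c b * c b = #|S|.
  rewrite -[RHS]sum1_card [RHS](partition_big (fun p => f p.1) (mem U0)) /=; last first.
    by move=> p; rewrite inE => /andP[pU _]; exact: (fU _ pU).
  apply: eq_bigr => b _; rewrite /c -cardsX -sum1_card; apply: eq_bigl => p.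
  rewrite !inE andbACA; case: (f p.1 =P b) => [<-|_]; last by rewrite !andbF.
  by rewrite andbT /= [f p.2 == _]eq_sym andbA.
have hS : (2 * K + 5) * #|U| <= #|S|.
  set L := 2 * K + 5 in hU0 *.
  have : \sum_(b in U0) 2 * L * c b <= \sum_(b in U0) (c b * c b + L * L).
    by apply: leq_sum => b _; rewrite !mulnn addnC -mulnA (nat_Cauchy L (c b)).
  rewrite -big_distrr /= cU big_split /= cS sum_nat_const.
  move: hU0; clear; move: #|U0| #|U| #|S| => a b d; nia.
pose D : {set V * V} := [set (x, x) | x in U].
pose P : {set V * V} := [set p | [set p.1; p.2] \in E].
have hP : #|P| <= 2 * #|E| by apply: card_edge_pairs => p; rewrite inE.
have hD : #|D| <= #|U| by exact: leq_imset_card.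
have : #|S :\: (D :|: P)| <= 2 * #|addable E U|.
  apply: card_edge_pairs => -[x y] xyS.
  rewrite in_setD in_setU !in_set negb_or /= in xyS.
  have /andP[/andP[nD nP] /and3P[xU yU /eqP fxy]] := xyS.
  have xy : x != y.
    by apply: contraNneq nD => <-; apply/imsetP; exists x.
  by apply: addableP => //; exact: h1.
have : #|S| <= #|S :\: (D :|: P)| + (#|D| + #|P|).
  rewrite -(cardsID (D :|: P) S) addnC leq_add2l.
  apply: leq_trans (leq_card_setU _ _); apply: subset_leq_card.
  exact: subsetIr.
move: hS hP hD hE; clear.
move: #|S| #|_ :\: _| #|D| #|P| #|E| #|U| #|addable E U| => a b c' d e g h; nia.
Qed.

Lemma addable_many E U K : supported E U -> pl E ->
  (2 * K + 5) * (21 * (2 * K + 4) + 20 * (#|E| - #|U|)) <= #|U| ->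
  #|E| <= 2 * #|U| -> K * #|U| <= #|addable E U|.
Proof.
move=> sE pE hU hE.
have [E0 [U0 [f [red nl nb]]]] := label_reduction_exists sE pE.
have [J4|J4] := leqP (2 * K + 4) #|joinable R E0 U0|.
  exact: addable_joinable red J4.
apply: (addable_labels sE pE red _ hE); apply: leq_trans hU.
rewrite leq_mul2l; apply/orP; right.
have [_ [sE0 pE0 card] _ _ _] := red.
have := terminal_bound sE0 pE0 nl nb; move: card J4; clear.
move: #|E0| #|U0| #|E| #|U| #|joinable R E0 U0| => a b c d e; lia.
Qed.

(** The planar graphs with M edges on the complement of [C], kept on the full vertex type so that
    the vertices of [C] can be attached later. *)
Definition avoiding C M := [set E : {set {set V}} |
  [&& `[< pl E >], #|E| == M & [forall e in E, e \subset ~: C]]].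

Lemma avoidingP C M E : reflect [/\ pl E, #|E| = M & supported E (~: C)]
  (E \in avoiding C M).
Proof.
rewrite inE; apply: (iffP and3P) => -[].
  move=> /asboolP pE /eqP EM /forall_inP h; split => // e eE; split; last exact: h.
  by have [p [a D]] := pE; exact: drawing_pair D eE.
move=> pE EM h; split; [exact/asboolP|exact/eqP|].
by apply/forall_inP => e /h[].
Qed.

(** Double counting of graphs with a chosen edge. With N = |~: C|, each smaller graph has at least
    2LN addable edges ([addable_many] with K = 2L), and each larger one arises from at most M + 1 <=
    2N pairs. *)
Lemma avoiding_step C M L :
  (4 * L + 5) * (21 * (4 * L + 4) + 20 * (M - #|~: C|)) <= #|~: C| ->
  M < 2 * #|~: C| -> L * #|avoiding C M| <= #|avoiding C M.+1|.
Proof.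
move=> hN hM; set N := #|~: C| in hN hM *.
pose A : {set {set {set V}} * {set V}} :=
  [set p | (p.1 \in avoiding C M) && (p.2 \in addable p.1 (~: C))].
pose A' : {set {set {set V}} * {set V}} :=
  [set p | (p.1 \in avoiding C M.+1) && (p.2 \in p.1)].
have hA : #|avoiding C M| * (2 * L * N) <= #|A|.
  rewrite (card_dep_pairs _ (fun E => addable E (~: C))) -sum_nat_const.
  apply: leq_sum => E /avoidingP[pE EM sE].
  apply: addable_many => //; rewrite EM -/N; last exact: ltnW.
  by rewrite !mulnA.
have hA' : #|A'| = #|avoiding C M.+1| * M.+1.
  rewrite (card_dep_pairs _ (fun E : {set {set V}} => E)) -sum_nat_const.
  apply: eq_bigr => E.
  by case/avoidingP.
have inj : {in A &, injective (fun p : {set {set V}} * {set V} => (p.2 |: p.1, p.2))}.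
  move=> [E e] [E' e']; rewrite !inE /= => /andP[_ /and4P[eE _ _ _]].
  move=> /andP[_ /and4P[eE' _ _ _]] [h ee]; rewrite -ee in h eE' *.
  by rewrite -(setU1K eE) h setU1K.
have : #|A| <= #|A'|.
  rewrite -(card_in_imset inj); apply/subset_leq_card/subsetP => _ /imsetP[[E e] h ->].
  move: h; rewrite inE /= => /andP[/avoidingP[pE EM sE]].
  rewrite inE => /and4P[eE e2 eC /asboolP pe]; rewrite inE /= setU11 andbT.
  apply/avoidingP; split => //; first by rewrite cardsU1 eE EM.
  by move=> e'; rewrite in_setU1 => /orP[/eqP ->|/sE //]; rewrite (eqP e2).
rewrite hA' => h; have N0 : 0 < N by rewrite lt0n; apply: contraTneq hM => ->.
rewrite -(leq_pmul2r (m := 2 * N)) ?muln_gt0 //.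
apply: leq_trans (leq_trans h _); last by rewrite leq_mul2l hM orbT.
apply: leq_trans hA; apply: eq_leq.
by rewrite -mulnA mulnCA (mulnA L 2) (mulnC L 2).
Qed.

(** The factor [L] is taken from the first added edge only; later ones are merely used not to
    decrease the count. The hypotheses are for the final number of edges and imply those of all
    earlier steps. *)
Lemma avoiding_gain C M s L : 0 < L -> 0 < s ->
  (4 * L + 5) * (21 * (4 * L + 4) + 20 * (M + s - #|~: C|)) <= #|~: C| ->
  M + s <= 2 * #|~: C| -> L * #|avoiding C M| <= #|avoiding C (M + s)|.
Proof.
move=> L0; case: s => // s _.
elim: s => [|s IH] h1 h2.
  rewrite addn1 in h1 h2 *; apply: avoiding_step => //.
  by apply: leq_trans h1; rewrite leq_mul2l leq_add2l leq_mul2l leq_sub2r ?orbT.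
have h1' : (4 * L + 5) * (21 * (4 * L + 4) + 20 * (M + s.+1 - #|~: C|)) <= #|~: C|.
  apply: leq_trans h1; rewrite leq_mul2l leq_add2l leq_mul2l leq_sub2r ?orbT //.
  by rewrite leq_add2l.
apply: leq_trans (IH h1' _) _; first by apply: leq_trans h2; rewrite leq_add2l.
rewrite [M + s.+2]addnS; apply: leq_trans (avoiding_step h1' _); last first.
  by rewrite -addnS.
by rewrite leq_pmull.
Qed.

(** The pair (E, v) can be recovered from the new graph: [E] consists of the edges that avoid [c],
    and [v] is the only neighbour of [c]. *)
Lemma avoiding_attach C M c : c \in C ->
  #|avoiding C M| * #|~: C| <= #|avoiding (C :\ c) M.+1|.
Proof.
move=> cC; rewrite -cardsX.
have inj : {in setX (avoiding C M) (~: C) &,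
    injective (fun p : {set {set V}} * V => [set p.2; c] |: p.1)}.
  have iso E : E \in avoiding C M -> isolated_in E c.
    by case/avoidingP=> _ _ /supported_isolated; apply; rewrite inE cC.
  have rec E v : E \in avoiding C M ->
      E = [set e in [set v; c] |: E | c \notin e] .
    move=> /iso ic; apply/setP => e; rewrite !inE.
    have [->|ne] /= := eqVneq e [set v; c].
      rewrite !inE eqxx orbT /=; apply/negP => /ic; by rewrite !inE eqxx orbT.
    by case: (boolP (e \in E)) => // /ic ->.
  move=> [E v] [E' v']; rewrite !in_setX /= => /andP[EA vC] /andP[EA' vC'] h.
  have EE : E = E' by rewrite (rec E v EA) h -(rec E' v' EA').
  rewrite -EE in h *; congr (_, _).
  have : [set v; c] \in [set v'; c] |: E by rewrite -h setU11.
  rewrite in_setU1 => /orP[/eqP/set2P_or[[]//|[vc _]]|/(iso _ EA)].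
    by move: vC; rewrite inE vc cC.
  by rewrite !inE eqxx orbT.
rewrite -(card_in_imset inj); apply/subset_leq_card/subsetP => _ /imsetP[[E v] h ->].
move: h; rewrite in_setX /= => /andP[/avoidingP[pE EM sE] vC].
have ic : isolated_in E c by apply: (supported_isolated sE); rewrite inE cC.
have vc : v != c by apply: contraTneq vC => ->; rewrite inE cC.
have nE : [set v; c] \notin E by apply/negP => /ic; rewrite !inE eqxx orbT.
apply/avoidingP; split; first exact: drawable_pendant.
  by rewrite cardsU1 nE EM.
rewrite inE in vC.
move=> e; rewrite in_setU1 => /orP[/eqP ->|/sE [e2 eC]].
  by rewrite cards2 vc subUset !sub1set !inE eqxx (negbTE vC) andbF.
split => //; apply: subset_trans eC _; rewrite setCS; exact: subD1set.
Qed.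

Lemma avoiding_attach_all C M :
  #|avoiding C M| * #|~: C| ^ #|C| <= #|avoiding set0 (M + #|C|)|.
Proof.
have [k] : {k | k = #|C|} by exists #|C|.
elim: k C M => [|k IH] C M Ck.
  have /eqP -> : C == set0 by rewrite -cards_eq0 -Ck.
  by rewrite cards0 expn0 muln1 addn0.
have /set0Pn[c cC] : C != set0 by rewrite -cards_eq0 -Ck.
have Ck' : k = #|C :\ c| by move: Ck; rewrite (cardsD1 c) cC => -[].
have := IH _ M.+1 Ck'; rewrite -Ck -Ck' addSnnS; apply: leq_trans.
rewrite expnS mulnA; apply: leq_mul; first exact: avoiding_attach.
have h : #|~: C| <= #|~: (C :\ c)|.
  by apply: subset_leq_card; rewrite setCS; exact: subD1set.
by case: (k) => [|k']; rewrite ?expn0 // leq_exp2r.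
Qed.

End Addable.

(** * What the count needs to know about a component *)

Section Components.
Local Open Scope nat_scope.

Lemma sgraph_edge (V : finType) (G : sgraph V) e : e \in edges G ->
  exists x y, e = [set x; y].
Proof.
move=> eG; have /cards2P[x [y [_ ->]]] := forall_inP (edges_card2 G) _ eG.
by exists x, y.
Qed.

Lemma isomorphic_card (V W : finType) (G : sgraph V) (H : sgraph W) :
  isomorphic G H -> #|V| = #|W| /\ #|edges G| = #|edges H|.
Proof.
move=> [f bf fadj]; split; first exact: bij_eq_card bf.
have fI := bij_inj bf; have [g fK gK] := bf.
have <- : [set f @: e | e : {set V} in edges G] = edges H.
  apply/setP => e; apply/imsetP/idP => [[e' e'G ->]|eH].
    have [x [y e_]] := sgraph_edge e'G; rewrite e_ in e'G *.
    by rewrite imsetU1 imset_set1; have := fadj x y; rewrite /adj e'G.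
  have [x [y e_]] := sgraph_edge eH; rewrite e_ in eH *.
  exists [set g x; g y]; last by rewrite imsetU1 imset_set1 !gK.
  by have := fadj (g x) (g y); rewrite /adj !gK eH => <-.
by rewrite card_imset //; exact: imset_inj.
Qed.

Lemma card_induced_edges (V : finType) (G : sgraph V) (C : {set V}) :
  #|edges (induced_subgraph G C)| = #|edges G :&: powerset C|.
Proof.
have inj : injective (fun e : {set {x : V | x \in C}} => val @: e).
  exact: imset_inj val_inj.
rewrite -(card_imset _ inj); apply: eq_card => e; rewrite !inE.
apply/imsetP/andP => [[e']|[eG /subsetP eC]].
  rewrite inE => e'G ->; split => //.
  by apply/subsetP => _ /imsetP[x _ ->]; exact: valP.
have ee : val @: [set x : {x : V | x \in C} | val x \in e] = e.
  apply/setP => x; apply/imsetP/idP => [[y]|xe]; first by rewrite inE => ye ->.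
  by exists (exist _ x (eC x xe)); rewrite ?inE.
by exists [set x : {x : V | x \in C} | val x \in e]; rewrite ?inE ee.
Qed.

Lemma component_edge (V : finType) (G : sgraph V) (C e : {set V}) :
  is_component G C -> e \in edges G -> (e \subset C) || (e \subset ~: C).
Proof.
move=> [x ->] eG; have [y [z e_]] := sgraph_edge eG; rewrite e_ in eG *.
have symG : connect_sym (adj G) by apply: sym_connect_sym => a b; rewrite /adj setUC.
have yz : connect (adj G) x y = connect (adj G) x z.
  by apply: same_connect_r => //; exact: connect1.
by rewrite !subUset !sub1set !inE yz; case: connect.
Qed.

(** Of a component isomorphic to [H] only its numbers of vertices and edges and its separation from
    the rest are retained. *)
Definition splitting (V : finType) k h (E : {set {set V}}) : Prop :=
  exists C : {set V}, [/\ #|C| = k, #|E :&: powerset C| = h &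
    forall e, e \in E -> (e \subset C) || (e \subset ~: C)].

Lemma has_component_splitting (V W : finType) (H : sgraph W) (G : sgraph V) :
  has_component_iso H G -> splitting #|W| #|edges H| (edges G).
Proof.
move=> [C CG /isomorphic_card[cV cE]]; exists C.
rewrite -cV card_sig -cE card_induced_edges; split => //.
by move=> e; exact: component_edge.
Qed.

End Components.

(** * Graphs that split off a dense piece are rare *)

Section Count.
Local Open Scope nat_scope.
Variables (R : realType) (V : finType).

(** A splitting graph is determined by [C], its edges inside [C] and its edges outside; the edges
    inside form one of at most 2 ^ (2 ^ k) sets of subsets of [C]. *)
Lemma splitting_card k h m : h <= m ->
  #|[set E in avoiding R set0 m | `[< @splitting V k h E >]]| <=
  \sum_(C : {set V} | #|C| == k) 2 ^ (2 ^ k) * #|avoiding R C (m - h)|.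
Proof.
move=> hm.
pose join (p : {set {set V}} * {set {set V}}) := p.1 :|: p.2.
have sub : [set E in avoiding R set0 m | `[< @splitting V k h E >]] \subset
    \bigcup_(C in [set C : {set V} | #|C| == k])
      join @: setX (powerset (powerset C)) (avoiding R C (m - h)).
  apply/subsetP => E; rewrite inE => /andP[/avoidingP[pE Em sE]].
  move=> /asboolP[C [Ck Eh split_]]; apply/bigcupP; exists C; rewrite ?inE ?Ck //.
  apply/imsetP; exists (E :&: powerset C, E :\: powerset C); last by rewrite /join setID.
  rewrite in_setX /= powersetE subsetIr /=; apply/avoidingP; split.
  - by apply: drawable_sub pE; exact: subsetDl.
  - by have := cardsID (powerset C) E; rewrite Eh Em => <-; rewrite addKn.
  - move=> e; rewrite in_setD powersetE => /andP[nC eE]; split; first by have [] := sE e eE.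
    by have := split_ e eE; rewrite (negbTE nC).
apply: leq_trans (subset_leq_card sub) _; apply: leq_trans (card_bigcup_le _ _) _.
rewrite (eq_bigl (fun C : {set V} => #|C| == k)); last by move=> C; rewrite inE.
apply: leq_sum => C /eqP Ck; apply: leq_trans (leq_imset_card _ _) _.
by rewrite cardsX !card_powerset Ck.
Qed.

(** For each [C], adding h - k edges outside [C] gains the factor [L], and attaching the k vertices
    of [C] gains N ^ k. The latter pays for the choice of [C], since 'C(|V|, k) <= |V| ^ k <= (2N) ^
    k. *)
Lemma splitting_rare k h m L : 0 < L -> k < h ->
  (4 * L + 5) * (21 * (4 * L + 4) + 20 * (m - (#|V| - k))) <= #|V| - k ->
  m <= 2 * (#|V| - k) -> #|V| <= 2 * (#|V| - k) ->
  L * #|[set E in avoiding R set0 m | `[< @splitting V k h E >]]| <=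
  2 ^ (2 ^ k + k) * #|avoiding R (@set0 V) m|.
Proof.
move=> L0 kh c1 c2 c3; set B := [set E in _ | _]; set A := avoiding R set0 m.
set N := #|V| - k in c1 c2 c3.
(* A member of [B] is needed only to know that h <= m, which makes the subtraction m - h exact. *)
have [->|/set0Pn[E]] := eqVneq B set0; first by rewrite cards0 muln0.
rewrite inE => /andP[/avoidingP[_ Em _] /asboolP[C0 [_ Eh _]]].
have hm : h <= m by rewrite -Em -Eh; exact/subset_leq_card/subsetIl.
have cC (C : {set V}) : #|C| == k -> #|~: C| = N.
  by move=> /eqP Ck; rewrite cardsCs setCK Ck.
have gain (C : {set V}) : #|C| == k ->
    L * #|avoiding R C (m - h)| * N ^ k <= #|A|.
  move=> Ck; have NC := cC C Ck.
  have hs : 0 < h - k by rewrite subn_gt0.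
  have e1 : m - h + (h - k) = m - k by lia.
  have := @avoiding_gain R V C (m - h) (h - k) L L0 hs; rewrite e1 NC => g.
  have := avoiding_attach_all R C (m - k); rewrite (eqP Ck) NC subnK; last first.
    by apply: leq_trans hm; exact: ltnW.
  apply: leq_trans; rewrite leq_mul2r g ?orbT //.
    apply: leq_trans c1; rewrite leq_mul2l leq_add2l leq_mul2l.
    by rewrite leq_sub2r ?orbT // leq_subr.
  by apply: leq_trans c2; exact: leq_subr.
have N0 : 0 < N by clear -c1; move: c1; case: N => //; nia.
have Nk : 0 < N ^ k by rewrite expn_gt0 N0.
rewrite -(leq_pmul2r Nk).
apply: (@leq_trans (\sum_(C : {set V} | #|C| == k) 2 ^ (2 ^ k) * #|A|)).
  rewrite (mulnC L) -mulnA; apply: leq_trans (leq_mul (splitting_card k hm) (leqnn _)) _.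
  rewrite big_distrl /=; apply: leq_sum => C Ck.
  rewrite -mulnA leq_mul2l; apply/orP; right.
  by rewrite mulnA (mulnC _ L) gain.
rewrite sum_nat_const mulnA [2 ^ (_ + _)]expnD.
rewrite (_ : #|_| = 'C(#|V|, k)); last first.
  by rewrite -card_draws -cardsE; apply: eq_card => C; rewrite !inE.
have bin : 'C(#|V|, k) <= 2 ^ k * N ^ k.
  rewrite -expnMn; apply: leq_trans (_ : #|V| ^ k <= _); last first.
    by case: (k) => [|k']; rewrite ?expn0 // leq_exp2r.
  apply: (@leq_trans (#|V| ^_ k)).
    by rewrite -bin_ffact leq_pmulr // fact_gt0.
  elim: (k) => // k' IH; rewrite ffactnSr expnSr; apply: leq_mul => //.
  exact: leq_subr.
apply: leq_trans (_ : 2 ^ k * N ^ k * 2 ^ (2 ^ k) * #|A| <= _).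
  by rewrite !leq_mul2r bin !orbT.
apply: eq_leq; move: (2 ^ (2 ^ k)) => c; move: (2 ^ k) (N ^ k) #|A| => a b d.
by clear; nia.
Qed.

End Count.

(** * The probability of a component *)

Section Probability.
Local Open Scope nat_scope.
Variable R : realType.

Lemma edges_inj (V : finType) : injective (@edges V).
Proof. exact: val_inj. Qed.

Lemma card_planar_graphs n m :
  #|planar_graphs R n m| = #|avoiding R (@set0 'I_n) m|.
Proof.
rewrite -(card_imset _ (@edges_inj _)); apply: eq_card => E.
apply/imsetP/avoidingP => [[G]|[pE Em sE]].
  rewrite inE => /andP[/eqP Gm /asboolP pG] ->; split => //; first exact/drawable_sedges.
  move=> e eG; rewrite setC0 subsetT; split => //.
  exact/eqP/(forall_inP (edges_card2 G)).
have E2 : [forall e in E, #|e| == 2%N] by apply/forall_inP => e /sE[->].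
exists (SGraph E2) => //; rewrite inE Em eqxx /=.
exact/asboolP/drawable_sedges.
Qed.

Lemma card_planar_component (W : finType) (H : sgraph W) n m :
  #|[set G in planar_graphs R n m | `[< has_component_iso H G >]]| <=
  #|[set E in avoiding R (@set0 'I_n) m | `[< splitting #|W| #|edges H| E >]]|.
Proof.
rewrite -(card_imset _ (@edges_inj _)); apply/subset_leq_card/subsetP => _ /imsetP[G h ->].
move: h; rewrite inE => /andP[]; rewrite inE => /andP[/eqP Gm /asboolP pG] /asboolP cG.
rewrite inE; apply/andP; split; last exact/asboolP/has_component_splitting.
apply/avoidingP; split => //; first exact/drawable_sedges.
move=> e eG; rewrite setC0 subsetT; split => //.
exact/eqP/(forall_inP (edges_card2 G)).
Qed.

Local Open Scope ring_scope.

Lemma component_pr_le (W : finType) (H : sgraph W) n m L :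
  (0 < L)%N -> (#|W| < #|edges H|)%N ->
  ((4 * L + 5) * (21 * (4 * L + 4) + 20 * (m - (n - #|W|))) <= n - #|W|)%N ->
  (m <= 2 * (n - #|W|))%N -> (n <= 2 * (n - #|W|))%N ->
  uniform_pr R (planar_graphs R n m) (has_component_iso H) <=
  (2 ^ (2 ^ #|W| + #|W|))%N%:R / L%:R.
Proof.
move=> L0 WH c1 c2 c3; rewrite /uniform_pr.
have [->|A0] := posnP #|planar_graphs R n m|; first by rewrite invr0 mulr0 divr_ge0.
rewrite ler_pdivrMr ?ltr0n // mulrAC ler_pdivlMr ?ltr0n // -!natrM ler_nat.
have := @splitting_rare R 'I_n #|W| #|edges H| m L L0 WH.
rewrite card_ord => /(_ c1 c2 c3); rewrite -card_planar_graphs; apply: leq_trans.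
by rewrite mulnC leq_mul2l card_planar_component orbT.
Qed.

End Probability.

Local Open Scope classical_set_scope.
Local Open Scope ring_scope.

Theorem theorem8p1 (R : realType) (m : nat -> nat) (eps : nat -> R)
  (eps0 : eps n @[n --> \oo] --> (0 : R))
  (m_le : \forall n \near \oo, (m n)%:R <= (1 + eps n) * n%:R)
  (W : finType) (H : sgraph W)
  (H_connected : connected_graph H)
  (H_planar : planar R H)
  (H_edges : (#|W| < #|edges H|)%N) :
  uniform_pr R (planar_graphs R n (m n)) (has_component_iso H)
    @[n --> \oo] --> (0 : R).
Proof.
apply/cvgrPdist_le => e e0.
pose K := (2 ^ (2 ^ #|W| + #|W|))%N; pose k := #|W|.
pose L := (Num.truncn (K%:R / e : R)).+1.
have KL : K%:R / L%:R <= e.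
  rewrite ler_pdivrMr ?ltr0n // mulrC -ler_pdivrMr //; apply/ltW.
  exact: truncnS_gt.
pose c1 := (4 * L + 5)%N.
have d0 : 0 < ((80 * c1)%:R : R)^-1 by rewrite invr_gt0 ltr0n.
have small : \forall n \near \oo, eps n <= ((80 * c1)%:R : R)^-1.
  move/cvgrPdist_le: eps0 => /(_ _ d0); apply: filterS => n.
  by rewrite sub0r normrN; apply: le_trans; exact: ler_norm.
(* The part of the requirement that does not grow with n is kept below n / 2. The part 20 c1 (m n -
   n) stays below n / 4, whence the factor 80 in the bound on [eps n]. The summand 4k ensures n <= 2
   (n - k) and m n <= 2 (n - k). *)
pose n0 := (2 * (c1 * (21 * (4 * L + 4) + 20 * k) + k) + 4 * k)%N.
have large : \forall n \near \oo, (n0 <= n)%N by exact: nbhs_infty_ge.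
near=> n.
rewrite sub0r normrN ger0_norm; last by rewrite divr_ge0.
apply: le_trans KL.
have hm : (80 * c1 * (m n - n) <= n)%N.
  have mn : (m n)%:R <= (1 + eps n) * n%:R by near: n.
  have en : eps n <= ((80 * c1)%:R : R)^-1 by near: n.
  have [le|lt] := leqP (m n) n.
    by move: le; rewrite -subn_eq0 => /eqP ->; rewrite muln0.
  rewrite -(ler_nat R) natrM natrB 1?ltnW // mulrC -ler_pdivlMr ?ltr0n //.
  rewrite lerBlDl; apply: le_trans mn _; rewrite mulrDl mul1r lerD2l mulrC.
  by rewrite ler_wpM2l.
have hn : (n0 <= n)%N by near: n.
have h : (20 * c1 * (m n - n) * 4 <= n)%N by move: hm; clear; lia.
apply: component_pr_le => //.
- rewrite -/c1 -/k; rewrite /n0 in hn; move: hn h; clear.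
  have : (m n - (n - k) <= (m n - n) + k)%N by lia.
  move: (m n - n)%N (m n - (n - k))%N => D D' DD'.
  move: (21 * _)%N => b hn h.
  have : (c1 * (b + 20 * D') <= c1 * (b + 20 * k) + 20 * c1 * D)%N.
    have -> : (c1 * (b + 20 * k) + 20 * c1 * D = c1 * (b + 20 * (D + k)))%N by lia.
    by rewrite leq_mul2l leq_add2l leq_mul2l DD' !orbT.
  move: hn h; move: (c1 * (b + 20 * k))%N (20 * c1 * D)%N (c1 * _)%N => x y z; lia.
- have : (4 * (m n - n) <= n)%N by move: h; rewrite /c1; clear; nia.
  by rewrite -/k; move: hn; rewrite /n0; move: (c1 * _)%N => x; clear; lia.
- by rewrite -/k; move: hn; rewrite /n0; move: (c1 * _)%N => x; clear; lia.
Unshelve. all: by end_near.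
Qed.
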